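(* Let $X$ be a Banach space not containing subspaces isomorphic to $\ell^1$. Then $X$ is reflexive if and only if $X$ has property (K).
   Context: All linear spaces are real; a subspace of a Banach space is a closed linear subspace. Given a sequence $(x_n)$ in a linear space, a convex block subsequence of $(x_n)$ is a sequence $(y_k)$ of the form $y_k=\sum_{n\in I_k}a_n x_n$, where $(I_k)$ is a sequence of finite subsets of $\mathbb{N}$ with $\max(I_k)<\min(I_{k+1})$ and $(a_n)$ is a sequence of non-negative real numbers with $\sum_{n\in I_k}a_n=1$ for all $k\in\mathbb{N}$. For a Banach space $X$, the Mackey topology $\mu(X^*,X)$ on $X^*$ is the topology of uniform convergence on weakly compact subsets of $X$. A Banach space $X$ has property (K) if every $w^*$-convergent sequence in $X^*$ admits a convex block subsequence which is $\mu(X^*,X)$-convergent. *)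

(* Defs.v *)
From HB Require Import structures.
From mathcomp Require Import all_boot all_order all_algebra finmap.
From mathcomp Require Import all_classical all_reals all_analysis.

Set Implicit Arguments.
Unset Strict Implicit.
Unset Printing Implicit Defensive.

Import Order.TTheory GRing.Theory Num.Theory.
Import numFieldNormedType.Exports.

Local Open Scope classical_set_scope.
Local Open Scope ring_scope.

Section dual_type.
Context {R : realType} (X : normedModType R).

Definition cont_linear : {pred X -> R^o} :=
  fun f => `[< linear f /\ continuous f >].

Record dual := Dual { dual_val :> X -> R^o ; _ : dual_val \in cont_linear }.

HB.instance Definition _ := [isSub for dual_val].
HB.instance Definition _ := [Choice of dual by <:].

Lemma cont_linear_submod_closed : submod_closed cont_linear.
Proof.
split.
  apply/asboolP; split; first by move=> a x y; rewrite scaler0 addr0.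
  by move=> x; exact: cvg_cst.
move=> a f g /asboolP[lf cf] /asboolP[lg cg]; apply/asboolP; split.
  move=> b x y.
  change (a *: f (b *: x + y) + g (b *: x + y) =
    b *: (a *: f x + g x) + (a *: f y + g y)).
  by rewrite lf lg !scalerDr !scalerA [b * a]mulrC addrACA.
move=> x; apply: cvgD; last exact: cg.
by apply: cvgZl_tmp; exact: cf.
Qed.

HB.instance Definition _ := GRing.isSubmodClosed.Build _ _ cont_linear
  cont_linear_submod_closed.
HB.instance Definition _ := [SubChoice_isSubLmodule of dual by <:].

Lemma dual_linear (f : dual) : linear f.
Proof. by case: f => f /= /asboolP[]. Qed.

Lemma dual_continuous (f : dual) : continuous f.
Proof. by case: f => f /= /asboolP[]. Qed.

HB.instance Definition _ (f : dual) :=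
  GRing.isLinear.Build R X R^o _ (dual_val f) (dual_linear f).

Lemma dualP (f g : dual) : f =1 g -> f = g.
Proof. by move=> fg; apply/val_inj/funext. Qed.

Definition dual_norm (f : dual) : R :=
  sup [set `|f x| | x in [set x : X | `|x| <= 1]].

Lemma dual_norm_has_sup (f : dual) :
  has_sup [set `|f x| | x in [set x : X | `|x| <= 1]].
Proof.
split; first by exists `|f 0|, 0 => //=; rewrite normr0.
have := continuous_linear_bounded 0 (@dual_continuous f 0).
move=> /bounded_funP/(_ 1)[M fM]; exists M => _ [x x1 <-]; exact: fM.
Qed.

Lemma dual_norm_ub (f : dual) (x : X) : `|f x| <= dual_norm f * `|x|.
Proof.
have [->|x0] := eqVneq x 0; first by rewrite linear0 !normr0 mulr0.
have nx0 : 0 < `|x| by rewrite normr_gt0.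
rewrite -ler_pdivrMr//.
have -> : `|f x| / `|x| = `|f (`|x|^-1 *: x)|.
  by rewrite linearZ normrZ normfV normr_id mulrC.
apply: ub_le_sup; first by case: (dual_norm_has_sup f).
exists (`|x|^-1 *: x) => //=.
by rewrite normrZ normfV normr_id mulVf// gt_eqF.
Qed.

Lemma dual_norm_le (f : dual) (M : R) :
  (forall x, `|x| <= 1 -> `|f x| <= M) -> dual_norm f <= M.
Proof.
move=> fM; apply: ge_sup; first by case: (dual_norm_has_sup f).
by move=> _ [x /= x1 <-]; exact: fM.
Qed.

Lemma dual_norm_ge0 (f : dual) : 0 <= dual_norm f.
Proof.
apply: (@le_trans _ _ `|f 0|) => //; apply: ub_le_sup.
  by case: (dual_norm_has_sup f).
by exists 0 => //=; rewrite normr0.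
Qed.

Let dual_norm_ball (f : dual) (x : X) : `|x| <= 1 -> `|f x| <= dual_norm f.
Proof.
move=> x1; apply: le_trans (dual_norm_ub f x) _.
by rewrite ler_piMr// dual_norm_ge0.
Qed.

Lemma dual_normD (f g : dual) : dual_norm (f + g) <= dual_norm f + dual_norm g.
Proof.
apply: dual_norm_le => x x1; apply: le_trans (ler_normD _ _) _.
by apply: lerD; exact: dual_norm_ball.
Qed.

Lemma dual_norm0_eq0 (f : dual) : dual_norm f = 0 -> f = 0.
Proof.
move=> f0; apply: dualP => x; apply/eqP; rewrite -normr_le0.
by apply: le_trans (dual_norm_ub f x) _; rewrite f0 mul0r.
Qed.

Lemma dual_normZ (a : R) (f : dual) : dual_norm (a *: f) = `|a| * dual_norm f.
Proof.
have le_normZ b (g : dual) : dual_norm (b *: g) <= `|b| * dual_norm g.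
  apply: dual_norm_le => x x1; rewrite [X in X <= _]normrM.
  by rewrite ler_wpM2l// dual_norm_ball.
apply/le_anti; rewrite le_normZ /=.
have [->|a0] := eqVneq a 0; first by rewrite normr0 mul0r dual_norm_ge0.
rewrite -ler_pdivlMl ?normr_gt0// -normfV.
by apply: le_trans (le_normZ _ _); rewrite scalerA mulVf// scale1r.
Qed.

HB.instance Definition _ := Lmodule_isNormed.Build R dual
  dual_normD dual_normZ dual_norm0_eq0.

End dual_type.

Section reflexivity.
Context {R : realType} (X : normedModType R).

Lemma bidual_eval_subproof (x : X) :
  (fun f : dual X => f x : R^o) \in @cont_linear R (dual X).
Proof.
have lx : linear (fun f : dual X => f x : R^o) by [].
apply/asboolP; split=> //.
pose L := GRing.isLinear.Build R (dual X) R^o _ _ lx.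
pose F : {linear dual X -> R^o} := HB.pack (fun f : dual X => f x : R^o) L.
apply: (@bounded_linear_continuous _ _ _ F); apply/bounded_funP => r.
exists (r * `|x|) => f fr; apply: le_trans (dual_norm_ub f x) _.
by rewrite ler_wpM2r.
Qed.

Definition bidual_eval (x : X) : dual (dual X) := Dual (bidual_eval_subproof x).

Definition reflexive_space : Prop := range bidual_eval = [set: dual (dual X)].

End reflexivity.

(* Each topology is carried by an alias of [X] or [dual X]; the types [X] and
   [dual X] themselves keep their norm topologies. *)

Section weak_topologies.
Context {R : realType} (X : normedModType R).

Definition weak : Type :=
  initial_topology (fun x : X => (fun f : dual X => f x) : {ptws dual X -> R^o}).
HB.instance Definition _ := Uniform.on weak.

Definition weakly_compact (K : set X) : Prop := compact (K : set weak).

Definition weak_star : Type :=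
  initial_topology (fun f : dual X => (f : X -> R^o) : {ptws X -> R^o}).
HB.instance Definition _ := Uniform.on weak_star.

Definition mackey : Type :=
  initial_topology
    (fun f : dual X => (f : X -> R^o) : {family weakly_compact, X -> R^o}).
HB.instance Definition _ := Uniform.on mackey.

End weak_topologies.

(* Each [I k] is nonempty since its coefficients sum to 1, so the condition on
   consecutive blocks is [max (I k) < min (I k.+1)]. *)
Definition convex_block_subsequence (R : realType) (V : lmodType R)
    (x y : nat -> V) : Prop :=
  exists (I : nat -> {fset nat}) (a : nat -> R),
    [/\ forall k m n, m \in I k -> n \in I k.+1 -> (m < n)%N,
        forall n, 0 <= a n,
        forall k, \sum_(n <- I k) a n = 1 &
        forall k, y k = \sum_(n <- I k) a n *: x n].

Definition property_K (R : realType) (X : normedModType R) : Prop :=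
  forall f : nat -> dual X,
    (exists l : weak_star X, (f : nat -> weak_star X) @ \oo --> l) ->
    exists2 g : nat -> dual X, convex_block_subsequence f g &
      exists l : mackey X, (g : nat -> mackey X) @ \oo --> l.

Section ell1_type.
Context (R : realType).

Definition abs_summable : {pred nat -> R^o} :=
  fun u => `[< cvgn [normed series u] >].

Record ell1 := Ell1 { ell1_val :> nat -> R^o ; _ : ell1_val \in abs_summable }.

HB.instance Definition _ := [isSub for ell1_val].
HB.instance Definition _ := [Choice of ell1 by <:].

Lemma normed_series_nondecreasing (u : nat -> R^o) :
  nondecreasing_seq [normed series u].
Proof. exact: (@nondecreasing_series R (fun n => `|u n|) xpredT 0). Qed.

Lemma abs_summable_bound (u : nat -> R^o) (M : R) :
  (forall n, [normed series u] n <= M) -> cvgn [normed series u].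
Proof.
move=> uM; apply: nondecreasing_is_cvgn.
  exact: normed_series_nondecreasing.
by exists M => _ [n _ <-].
Qed.

Lemma abs_summable_le_lim (u : nat -> R^o) n : cvgn [normed series u] ->
  [normed series u] n <= limn [normed series u].
Proof.
by move=> cu; apply: nondecreasing_cvgn_le => //; exact: normed_series_nondecreasing.
Qed.

Lemma normed_seriesD_le (u v : nat -> R^o) n :
  [normed series (u + v)] n <= [normed series u] n + [normed series v] n.
Proof. by rewrite /= /series /= -big_split ler_sum // => i _; exact: ler_normD. Qed.

Lemma normed_seriesZ (a : R) (u : nat -> R^o) :
  [normed series (a *: u)] = `|a| *: [normed series u].
Proof.
apply/funext => n; rewrite /= /series /= [RHS]mulr_sumr.
by apply: eq_bigr => i _; exact: normrM.
Qed.

Lemma abs_summable_submod_closed : submod_closed abs_summable.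
Proof.
split.
  apply/asboolP; apply: (@abs_summable_bound _ 0) => n.
  by rewrite /= /series /= big1// => i _; rewrite normr0.
move=> a u v /asboolP cu /asboolP cv; apply/asboolP.
apply: (@abs_summable_bound _
  (`|a| * limn [normed series u] + limn [normed series v])) => n.
apply: le_trans (normed_seriesD_le _ _ _) _.
apply: lerD; last exact: abs_summable_le_lim.
rewrite normed_seriesZ; apply: ler_wpM2l => //; exact: abs_summable_le_lim.
Qed.

HB.instance Definition _ := GRing.isSubmodClosed.Build _ _ abs_summable
  abs_summable_submod_closed.
HB.instance Definition _ := [SubChoice_isSubLmodule of ell1 by <:].

Definition ell1_norm (u : ell1) : R := limn [normed series u].

Lemma ell1_summable (u : ell1) : cvgn [normed series u].
Proof. by case: u => u /= /asboolP. Qed.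

Lemma ell1_normD (u v : ell1) : ell1_norm (u + v) <= ell1_norm u + ell1_norm v.
Proof.
rewrite {1}/ell1_norm; apply: limr_le; first exact: ell1_summable.
apply: nearW => n; apply: le_trans (normed_seriesD_le u v n) _.
by apply: lerD; apply: abs_summable_le_lim; exact: ell1_summable.
Qed.

Lemma ell1_normZ (a : R) (u : ell1) : ell1_norm (a *: u) = `|a| * ell1_norm u.
Proof.
rewrite /ell1_norm -[RHS]limZl_tmp; last exact: ell1_summable.
by rewrite -normed_seriesZ.
Qed.

Lemma ell1_norm0_eq0 (u : ell1) : ell1_norm u = 0 -> u = 0.
Proof.
move=> u0; apply/val_inj/funext => n.
have : `|u n| <= ell1_norm u.
  apply: (@le_trans _ _ ([normed series u] n.+1)).
    by rewrite /= /series /= big_nat_recr//= lerDr sumr_ge0.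
  exact/abs_summable_le_lim/ell1_summable.
by rewrite u0 normr_le0 => /eqP.
Qed.

HB.instance Definition _ := Lmodule_isNormed.Build R ell1
  ell1_normD ell1_normZ ell1_norm0_eq0.

End ell1_type.

Definition closed_subspace (R : realType) (X : normedModType R) (Y : set X)
    : Prop :=
  [/\ closed Y, Y 0 & forall (a : R) x y, Y x -> Y y -> Y (a *: x + y)].

(* [T] is a linear homeomorphism of [E] onto [Y], with inverse [S]; the values
   of [S] outside [Y] are irrelevant. *)
Definition contains_isomorphic_subspace (R : realType) (X E : normedModType R)
    : Prop :=
  exists2 Y : set X, closed_subspace Y &
    exists (T : {linear E -> X}) (S : X -> E),
      [/\ continuous T, {within Y, continuous S}, forall e, Y (T e),
          forall e, S (T e) = e & forall y, Y y -> T (S y) = y].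

(* Main.v *)
Require Import Defs.
From HB Require Import structures.
From mathcomp Require Import all_boot all_order all_algebra finmap.
From mathcomp Require Import all_classical all_reals all_analysis.
From mathcomp Require Import ring lra zify.

(* [=>] For reflexive X, w*-convergence in X* is weak convergence, so Mazur's
   lemma gives norm convergent convex blocks; weakly compact sets are bounded
   (Banach-Steinhaus on the dual), so norm convergence implies Mackey convergence.

   [<=] If X is not reflexive, the Hahn-Banach and Goldstine theorems give
   bounded sequences f_n in X* and x_k in X with f_n(x_k) close to 0 for n > k
   and bounded below by a constant close to theta > 0 for n <= k.  Since X does
   not contain l1, Bourgain's theorem makes some convex blocks of f_n
   w*-convergent, property (K) makes further blocks g_n Mackey convergent, and
   Rosenthal's theorem gives a weakly Cauchy subsequence of x_k.  Differences
   of its terms form a weakly null sequence y_i, so {0} U {y_i} is weakly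
   compact; yet g_n does not converge uniformly on it, because g_n(y_i) is large
   for some n growing with i while g_m(y_i) is small for every later m.

   The theorems of Bourgain and of Rosenthal share their construction of l1: a
   dyadic tree of nonempty sets of functionals, each split at its k-th level by
   the two half-spaces f(x_k) >= hi and f(x_k) <= lo of one vector x_k. *)

Set Implicit Arguments.
Unset Strict Implicit.
Unset Printing Implicit Defensive.

Import Order.TTheory GRing.Theory Num.Theory.
Import numFieldNormedType.Exports.

Local Open Scope classical_set_scope.
Local Open Scope ring_scope.

(** * Hahn-Banach, separation and the bidual *)

Section sublinear.
Context {R : realType} {V : lmodType R}.
Implicit Types (p q : V -> R) (x y : V) (E : V -> set R).

(** Homogeneity is an inequality for positive scalars only: the inverse scalar gives the converse,
    and [p 0 = 0] follows. *)
Definition sublinear p :=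
  (forall x y, p (x + y) <= p x + p y) /\
  (forall a x, 0 < a -> p (a *: x) <= a * p x).

Lemma sublinear0 p : sublinear p -> p 0 = 0.
Proof.
move=> [_ pZ].
have := pZ 2 0 ltac:(lra); have := pZ 2^-1 0 ltac:(lra); rewrite !scaler0; lra.
Qed.

Lemma sublinear_geN p x : sublinear p -> - p (- x) <= p x.
Proof.
move=> sp; have := sp.1 x (- x); rewrite subrr (sublinear0 sp); lra.
Qed.

(** Common scheme for the three infima below: the tested functional, the lower bound of a chain, and
    the gauge. The minorant [l] keeps the infima finite. *)
Lemma sublinear_inf E (l : V -> R) :
  (forall x, E x !=set0) -> (forall x u, E x u -> l x <= u) ->
  (forall x y u v, E x u -> E y v -> exists2 w, E (x + y) w & w <= u + v) ->
  (forall a x u, 0 < a -> E x u -> exists2 w, E (a *: x) w & w <= a * u) ->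
  sublinear (fun x => inf (E x)).
Proof.
move=> E0 El ED EZ.
have lbE x : has_lbound (E x) by exists (l x) => u /El.
split=> [x y|a x a0].
  suff H u : E x u -> inf (E (x + y)) - u <= inf (E y).
    have : inf (E (x + y)) - inf (E y) <= inf (E x).
      by apply: lb_le_inf => // u /H; lra.
    lra.
  move=> Eu; apply: lb_le_inf => // v Ev.
  have [w Ew wuv] := ED _ _ _ _ Eu Ev.
  have := ge_inf (lbE _) Ew; lra.
rewrite -ler_pdivrMl//; apply: lb_le_inf => // u Eu.
have [w Ew wu] := EZ _ _ _ a0 Eu.
rewrite ler_pdivrMl//; apply: le_trans wu; exact: ge_inf.
Qed.

(* Minimality is tested against [z |-> inf (p (z + t *: y) - t * p y)], [0 <= t]. *)
Lemma minimal_sublinear_linear p : sublinear p ->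
  (forall q, sublinear q -> (forall x, q x <= p x) -> q = p) ->
  linear (p : V -> R^o).
Proof.
move=> sp pmin.
have pD x y : p (x + y) = p x + p y.
  apply/le_anti; rewrite sp.1 /=.
  pose E z := [set p (z + t *: y) - t * p y | t in [set t | 0 <= t]].
  have El z u : E z u -> - p (- z) <= u.
    move=> [t /= t0 <-]; move: t0; rewrite le_eqVlt => /orP[/eqP<-|t0].
      by rewrite scale0r addr0 mul0r subr0; exact: sublinear_geN.
    have := sp.1 (z + t *: y) (- z); rewrite addrAC subrr add0r.
    have := sp.2 t^-1 (t *: y) ltac:(by rewrite invr_gt0).
    rewrite scalerA mulVf ?gt_eqF// scale1r ler_pdivlMl//; lra.
  have sE : sublinear (fun z => inf (E z)).
    apply: (@sublinear_inf _ (fun z => - p (- z))) => //.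
    - by move=> z; exists (p (z + 0 *: y) - 0 * p y), 0 => /=.
    - move=> z z' _ _ [t /= t0 <-] [t' /= t'0 <-].
      eexists; first by exists (t + t'); [rewrite /= addr_ge0|reflexivity].
      have := sp.1 (z + t *: y) (z' + t' *: y).
      rewrite addrACA -scalerDl; lra.
    - move=> a z _ a0 [t /= t0 <-].
      eexists; first by exists (a * t); [rewrite /= mulr_ge0// ltW|reflexivity].
      have := sp.2 a (z + t *: y) a0; rewrite scalerDr scalerA; lra.
  have lbE z : has_lbound (E z) by exists (- p (- z)) => u /El.
  (* The value [t = 0] puts this functional below [p], so minimality makes them equal; then [t = 1]
     bounds [p x] by [p (x + y) - p y]. *)
  have pE : (fun z => inf (E z)) = p.
    apply: pmin => // z; apply: ge_inf => //; exists 0 => //=.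
    by rewrite scale0r addr0 mul0r subr0.
  rewrite -lerBrDr -[in leLHS]pE.
  by apply: ge_inf => //; exists 1 => //=; rewrite scale1r mul1r.
have pN x : p (- x) = - p x.
  by have := pD x (- x); rewrite subrr (sublinear0 sp); lra.
have pZ0 a x : 0 < a -> p (a *: x) = a * p x.
  move=> a0; apply/le_anti; rewrite sp.2//= -ler_pdivlMl//.
  by rewrite -[X in p X <= _](@scalerK _ _ a) ?gt_eqF// sp.2// invr_gt0.
move=> a x y; rewrite pD; congr (_ + _).
have [a0|a0|->] := ltrgt0P a; last first.
- by rewrite !scale0r (sublinear0 sp).
- by rewrite -[a]opprK scaleNr pN pZ0 ?oppr_gt0// scaleNr.
- exact: pZ0.
Qed.

(** Zorn's lemma on the sublinear functionals below [q], with the order reversed so that a maximal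
    element is a minimal functional, hence linear. A chain is bounded by its pointwise infimum,
    finite because every member is at least [- q (- x)]. *)
Theorem hahn_banach q : sublinear q ->
  exists2 p : V -> R^o, linear p & forall x, p x <= q x.
Proof.
move=> sq.
pose T := {p : V -> R | sublinear p /\ forall x, p x <= q x}.
pose leT (p1 p2 : T) := `[< forall x, sval p2 x <= sval p1 x >].
have [||||[p [sp pq]] pmin] := @Zorn T leT.
- by move=> t; apply/asboolP.
- move=> r s t /asboolP rs /asboolP st; apply/asboolP => x.
  exact: le_trans (st x) (rs x).
- move=> [s Ps] [t Pt] /asboolP /= st /asboolP /= ts; apply: eq_exist.
  by apply/funext => x; apply/le_anti; rewrite st ts.
- move=> A totA; have [->|/set0P A0] := eqVneq A set0.
    by exists (exist _ q (conj sq (fun x => lexx (q x)))).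
  pose E x := [set sval t x | t in A].
  have El x u : E x u -> - q (- x) <= u.
    move=> [[t [st tq]] At /= <-].
    by apply: le_trans (sublinear_geN x st); rewrite lerN2.
  have lbE x : has_lbound (E x) by exists (- q (- x)) => u /El.
  have sE : sublinear (fun x => inf (E x)).
    apply: (@sublinear_inf _ (fun x => - q (- x))) => //.
    - by move=> x; case: A0 => t At; exists (sval t x), t.
    - move=> x y _ _ [s As <-] [t At <-].
      have [r [Ar rs rt]] : exists r, [/\ A r, forall x, sval r x <= sval s x &
          forall x, sval r x <= sval t x].
        by have [/asboolP st|/asboolP ts] := totA _ _ As At; [exists t|exists s].
      exists (sval r (x + y)); first by exists r.
      have := (svalP r).1.1 x y; have := rs x; have := rt y; lra.
    - move=> a x _ a0 [s As <-]; exists (sval s (a *: x)); first by exists s.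
      exact: (svalP s).1.2.
  have Eq x : inf (E x) <= q x.
    case: A0 => t At; apply: (@le_trans _ _ (sval t x)).
      by apply: ge_inf => //; exists t.
    exact: (svalP t).2.
  pose t : T := exist _ (fun x => inf (E x)) (conj sE Eq).
  exists t => s As; apply/asboolP => x /=.
  by apply: ge_inf => //; exists s.
- exists p => //; apply: minimal_sublinear_linear => // r sr rp.
  have rq x : r x <= q x by exact: le_trans (pq x).
  pose t : T := exist _ r (conj sr rq).
  by have /(_ ltac:(exact/asboolP))/(congr1 sval) := pmin t.
Qed.

End sublinear.

Definition convex_subset {R : realType} {V : lmodType R} (C : set V) :=
  forall (a b : R) x y, 0 <= a -> 0 <= b -> a + b = 1 -> C x -> C y ->
    C (a *: x + b *: y).

Section dual_theory.
Context {R : realType}.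
Implicit Types V W : normedModType R.

Lemma dual_ler_norm V (f : dual V) x : `|f x| <= `|f| * `|x|.
Proof. exact: dual_norm_ub. Qed.

Lemma dual_le_ball V (f : dual V) x : `|f| <= 1 -> `|x| <= 1 -> `|f x| <= 1.
Proof.
move=> f1 x1; apply: le_trans (dual_ler_norm f x) _.
by rewrite -[leRHS]mulr1 ler_pM.
Qed.

Lemma dual_of_bounded V (F : V -> R^o) (M : R) : linear F ->
  (forall x, `|F x| <= M * `|x|) ->
  exists2 f : dual V, `|f| <= `|M| & forall x, f x = F x.
Proof.
move=> lF bF.
suff cF : F \in @cont_linear R V.
  exists (Dual cF) => //; apply: dual_norm_le => x x1 /=.
  apply: le_trans (bF x) _; apply: le_trans (ler_norm _) _.
  by rewrite normrM normr_id ler_piMr.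
apply/asboolP; split=> //.
pose L := GRing.isLinear.Build R V R^o _ _ lF.
pose G : {linear V -> R^o} := HB.pack F L.
apply: (@bounded_linear_continuous _ _ _ G); apply/bounded_funP => r.
exists (`|M| * r) => x xr; apply: le_trans (bF x) _.
apply: le_trans (ler_norm _) _.
by rewrite normrM normr_id ler_wpM2l.
Qed.

(* Hahn-Banach for the gauge [q x = inf (`|x + t *: (c - p)| - t * r)] over
   [0 <= t] and [c] in [C]. *)
Theorem separation V (C : set V) (p : V) (r : R) : convex_subset C ->
  C !=set0 -> (forall c, C c -> r <= `|c - p|) ->
  exists2 f : dual V, `|f| <= 1 & forall c, C c -> f p + r <= f c.
Proof.
move=> convC [c0 Cc0] Cr.
pose E x := [set u | exists t c, [/\ 0 <= t, C c &
  u = `|x + t *: (c - p)| - t * r]].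
have El x u : E x u -> - `|x| <= u.
  move=> [t [c [t0 Cc ->]]].
  have := ler_normB (x + t *: (c - p)) x.
  rewrite addrAC subrr add0r normrZ ger0_norm//.
  have := ler_wpM2l t0 (Cr _ Cc); lra.
have Ex0 x : E x `|x|.
  by exists 0, c0; split=> //; rewrite scale0r addr0 mul0r subr0.
have lbE x : has_lbound (E x) by exists (- `|x|) => u /El.
have sE : sublinear (fun x => inf (E x)).
  apply: (@sublinear_inf _ _ _ (fun x => - `|x|)) => //.
  - by move=> x; exists `|x|.
  - move=> x y _ _ [t [c [t0 Cc ->]]] [s [d [s0 Cd ->]]].
    have [ts0|ts0] := eqVneq (t + s) 0.
      have [-> ->] : t = 0 /\ s = 0 by split; lra.
      exists `|x + y|; first exact: Ex0.
      by rewrite !scale0r !addr0 !mul0r !subr0 ler_normD.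
    have ts_ge0 : 0 <= t + s by apply: addr_ge0.
    pose e := (t / (t + s)) *: c + (s / (t + s)) *: d.
    exists (`|x + y + (t + s) *: (e - p)| - (t + s) * r).
      exists (t + s), e; split=> //.
      apply: convC => //; [exact: divr_ge0|exact: divr_ge0|].
      by rewrite -mulrDl mulfV.
    have -> : x + y + (t + s) *: (e - p) =
        (x + t *: (c - p)) + (y + s *: (d - p)).
      rewrite [RHS]addrACA; congr (_ + _).
      rewrite /e scalerBr scalerDr !scalerA ![(t + s) * _]mulrC !divfK//.
      by rewrite !scalerBr scalerDl opprD addrACA.
    by have := ler_normD (x + t *: (c - p)) (y + s *: (d - p)); lra.
  - move=> a x _ a0 [t [c [t0 Cc ->]]].
    eexists; first by exists (a * t), c; split=> //; rewrite mulr_ge0// ltW.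
    by rewrite -scalerA -scalerDr normrZ gtr0_norm//; lra.
have [F lF Fq] := hahn_banach sE.
pose L := GRing.isLinear.Build R V R^o _ _ lF.
pose G : {linear V -> R^o} := HB.pack F L.
have Fle x : F x <= `|x|.
  by apply: le_trans (Fq x) _; apply: ge_inf.
have Fbnd x : `|F x| <= 1 * `|x|.
  rewrite mul1r ler_norml Fle andbT lerNl -normrN.
  by have := Fle (- x); rewrite -[F (- x)]/(G (- x)) linearN.
have [f f1 fF] := dual_of_bounded lF Fbnd.
exists f => [|c Cc]; first by rewrite (le_trans f1)// normr1.
(* At [x = p - c] and [t = 1] the norm in the gauge vanishes, leaving [- r]. *)
have : F (p - c) <= - r.
  apply: le_trans (Fq _) _; apply: ge_inf => //; exists 1, c; split=> //.
  by rewrite scale1r -[c - p]opprB subrr normr0 mul1r sub0r.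
rewrite -fF linearB/=; lra.
Qed.

(** Separating [x] from the singleton 0, at distance [|x|], gives [f x + |x| <= 0], so [- f] is
    norming. *)
Lemma norming_functional V (x : V) : exists2 f : dual V, `|f| <= 1 & f x = `|x|.
Proof.
have [|||f f1 fx] := @separation V [set 0] x `|x|.
- by move=> a b _ _ _ _ _ -> ->; rewrite !scaler0 addr0.
- by exists 0.
- by move=> _ ->; rewrite sub0r normrN.
exists (- f); first by rewrite normrN.
have fx_le : f x + `|x| <= 0 by have := fx 0 erefl; rewrite linear0.
have fx_ge : - f x <= `|x|.
  rewrite (le_trans (ler_norm _))// normrN (le_trans (dual_ler_norm _ _))//.
  by rewrite ler_piMl.
by apply/le_anti/andP; split; [exact: fx_ge|change (`|x| <= - f x); lra].
Qed.

Lemma bidual_eval_norm V (x : V) : `|bidual_eval x| = `|x|.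
Proof.
apply/le_anti/andP; split.
  apply: dual_norm_le => f f1 /=; apply: le_trans (dual_ler_norm f x) _.
  by rewrite ler_piMl.
have [f f1 <-] := norming_functional x.
apply: le_trans (ler_norm _) _; change (f x) with (bidual_eval x f).
by apply: le_trans (dual_ler_norm _ _) _; rewrite ler_piMr.
Qed.

(** Otherwise the vector [p] of values of [Phi] stays at distance at least [e] from the convex set
    of vectors [ev x]. A functional separating them is given by a combination [g] of the [a i], and
    [|g| <= - Phi g - e] contradicts [|Phi| <= 1]. *)
Theorem goldstine V (Phi : dual (dual V)) (fs : seq (dual V)) (e : R) :
  `|Phi| <= 1 -> 0 < e ->
  exists2 x : V, `|x| <= 1 & forall f, f \in fs -> `|f x - Phi f| <= e.
Proof.
move=> Phi1 e0; apply: contrapT => nex.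
pose n := (size fs).
(* One index past the end of the list, where [a] is 0, keeps the space of row vectors nontrivial
   even for an empty list. *)
pose a (i : 'I_n.+1) : dual V := fs`_i.
pose ev (x : V) : 'rV[R]_n.+1 := \row_i a i x.
pose p : 'rV[R]_n.+1 := \row_i Phi (a i).
have [|||F F1 FC] := @separation _ [set ev x | x in [set x | `|x| <= 1]] p e.
- move=> s t _ _ s0 t0 st [x /= x1 <-] [y /= y1 <-].
  exists (s *: x + t *: y) => /=.
    apply: le_trans (ler_normD _ _) _; rewrite !normrZ !ger0_norm//.
    by have := ler_wpM2l s0 x1; have := ler_wpM2l t0 y1; lra.
  by apply/rowP => i; rewrite !mxE linearD !linearZ.
- by exists (ev 0), 0 => //=; rewrite normr0.
- move=> _ [x /= x1 <-]; rewrite leNgt; apply/negP => xe; apply: nex.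
  exists x => // f ffs; have fi : (index f fs < n.+1)%N by rewrite ltnS index_size.
  have : `|(ev x - p) 0 (Ordinal fi)| <= `|ev x - p|.
    rewrite [leRHS]mx_normrE.
    exact: (le_bigmax _ (fun i => `|(ev x - p) i.1 i.2|) (0, Ordinal fi)).
  by rewrite !mxE /a/= nth_index// => /le_trans; apply; exact: ltW.
pose c i := F (delta_mx 0 i).
have FE (v : 'rV[R]_n.+1) : F v = \sum_i v 0 i * c i.
  rewrite {1}(row_sum_delta v) linear_sum; apply: eq_bigr => i _.
  by rewrite linearZ.
pose g : dual V := \sum_i c i *: a i.
have FCe x : `|x| <= 1 -> F p + e <= F (ev x) by move=> x1; apply: FC; exists x.
have gE x : g x = F (ev x).
  rewrite FE /g.
  have -> : (\sum_i c i *: a i) x = bidual_eval x (\sum_i c i *: a i) by [].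
  rewrite linear_sum; apply: eq_bigr => i _.
  by rewrite linearZ mxE mulrC.
have PhigE : Phi g = F p.
  rewrite FE /g linear_sum; apply: eq_bigr => i _.
  by rewrite linearZ mxE mulrC.
have : `|g| <= - Phi g - e.
  apply: dual_norm_le => x x1; rewrite PhigE ler_norml gE; apply/andP; split.
    by have := FCe x x1; lra.
  have -> : F (ev x) = - F (ev (- x)).
    by rewrite -!gE linearN opprK.
  by have := FCe (- x); rewrite normrN => /(_ x1); lra.
have : - Phi g <= `|g|.
  rewrite (le_trans (ler_norm _))// normrN (le_trans (dual_ler_norm _ _))//.
  by rewrite ler_piMl.
lra.
Qed.

End dual_theory.

(** * Topologies on the dual *)

Lemma initial_cvgP (S : choiceType) (T : topologicalType) (f : S -> T)
    (F : set_system S) (s : S) : Filter F ->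
  F --> (s : initial_topology f) <-> f @ F --> f s.
Proof.
move=> FF; split=> [Fs|Ffs A [_ [[B Bop <-] Bfs sBfA]]].
  apply: cvg_trans (@initial_continuous _ _ f s); exact: cvg_app.
by apply: (filterS sBfA); apply: Ffs; apply: open_nbhs_nbhs.
Qed.

Section topologies.
Context {R : realType} {X : normedModType R}.

Lemma weak_star_cvgP (F : set_system (dual X)) (l : dual X) : Filter F ->
  F --> (l : weak_star X) <-> forall x, (f : dual X) x @[f --> F] --> l x.
Proof.
by move=> FF; rewrite initial_cvgP pointwise_cvgP.
Qed.

Lemma weak_cvgP (F : set_system X) (l : X) : Filter F ->
  F --> (l : weak X) <-> forall f : dual X, f x @[x --> F] --> f l.
Proof.
by move=> FF; rewrite initial_cvgP pointwise_cvgP.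
Qed.

Lemma mackey_cvgP (F : set_system (dual X)) (l : dual X) : Filter F ->
  F --> (l : mackey X) <-> forall K : set X, weakly_compact K ->
    forall e : R, 0 < e ->
    \forall f \near F, forall x, K x -> `|(f : dual X) x - l x| < e.
Proof.
move=> FF; rewrite initial_cvgP fam_cvgP.
split=> [Fl K wK e e0|Fl K wK P].
  apply: (Fl K wK [set h : X -> R^o | forall x, K x -> `|h x - l x| < e]).
  rewrite uniform_nbhs.
  exists [set xy : R^o * R^o | ball xy.1 e xy.2]; split.
    exact: entourage_ball (PosNum e0).
  by move=> f fl x Kx; rewrite distrC; have := fl _ Kx.
rewrite uniform_nbhs => -[E [entE EP]].
have [e /= e0 eE] : exists2 e : R, 0 < e & [set xy : R^o * R^o | ball xy.1 e xy.2] `<=` E.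
  by move: entE; rewrite -entourage_ballE => -[e e0 eE]; exists e.
apply: (@filterS _ F _ [set f : dual X | forall x, K x -> `|f x - l x| < e]).
  move=> f fl; apply: EP => x Kx; apply: eE => /=.
  by rewrite -ball_normE /= distrC; exact: fl.
exact: Fl.
Qed.

(** The member of a cover that contains 0 contains a tail of [y]; each of the remaining [N] terms
    needs one more. *)
Lemma weakly_compact_cvg0 (y : nat -> X) :
  (forall f : dual X, f (y n) @[n --> \oo] --> 0) ->
  weakly_compact ([set 0] `|` range y).
Proof.
move=> y0; have y0w : y @ \oo --> (0 : weak X).
  by apply/weak_cvgP => f; rewrite linear0; exact: y0.
rewrite /weakly_compact compact_cover => I D f fo cov.
have [i Di fi0] := cov 0 (or_introl erefl).
have /y0w[N _ Ny] : nbhs (0 : weak X) (f i) by apply: open_nbhs_nbhs; split; [exact: fo|].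
have /choice[j jP] n : exists i, D i /\ f i (y n).
  have [//|k Dk fk] := cov (y n); first by right; exists n.
  by exists k.
exists [fset k | k in i :: [seq j n | n <- iota 0 N]]%fset.
  move=> _ /imfsetP[/= k + ->]; rewrite inE => /orP[/eqP->|/mapP[n _ ->]].
    exact: Di.
  by case: (jP n).
move=> _ [->|[n _ <-]]; first by exists i; rewrite //= !inE eqxx.
have [Nn|nN] := leqP N n.
  by exists i; [rewrite //= !inE eqxx|exact: Ny].
exists (j n); last by case: (jP n).
by rewrite /= !inE map_f ?orbT// mem_iota.
Qed.

End topologies.

(** * Pointwise limits of functionals and completeness of the dual *)

Section dual_complete.
Context {R : realType} (V : normedModType R).

(** Stated for filters, as it serves both the Cauchy filters of [dual_complete] and the sequence in
    [bourgain]. *)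
Lemma dual_ptws_lim (F : set_system (dual V)) (M : R) : ProperFilter F ->
  (\forall f \near F, `|f| <= M) -> (forall x, cvg ((f : dual V) x @[f --> F])) ->
  exists2 l : dual V, `|l| <= `|M| & forall x, (f : dual V) x @[f --> F] --> (l x : R^o).
Proof.
move=> FF FM Fcvg; pose L x : R^o := lim ((f : dual V) x @[f --> F]).
have FL x : (f : dual V) x @[f --> F] --> L x by exact: Fcvg.
have linL : linear L.
  move=> a x y.
  apply: (@cvg_lim _ (@norm_hausdorff _ _)).
  have -> : (fun f : dual V => f (a *: x + y) : R^o) = (fun f => a *: f x + f y).
    by apply/funext => f; rewrite linearD linearZ.
  by apply: cvgD (FL y); apply: cvgZl_tmp; exact: FL.
have [|l lM lE] := @dual_of_bounded _ _ L M linL.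
  move=> x; have cL : `|(f : dual V) x| @[f --> F] --> `|L x| by apply: cvg_norm; exact: FL.
  rewrite -(cvg_lim _ cL)//; apply: limr_le; first by apply/cvg_ex; exists `|L x|.
  near=> f; apply: le_trans (dual_ler_norm f x) _.
  by rewrite ler_wpM2r//; near: f.
by exists l => // x; rewrite lE; exact: FL.
Unshelve. all: by end_near. Qed.

(** Makes the Banach-Steinhaus theorem available on [dual X]. The limit is first found pointwise,
    then shown to be a limit in norm. *)
Lemma dual_complete (F : set_system (dual V)) :
  ProperFilter F -> cauchy F -> cvg F.
Proof.
move=> FF /cauchyP Fc.
have {}Fc e : 0 < e -> exists f, \forall g \near F, `|f - g| < e.
  by move=> /Fc[f Ff]; exists f; move: Ff; rewrite -ball_normE.
have [f1 f1P] := Fc 1 ltr01.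
have [||l _ Fl] := @dual_ptws_lim F (`|f1| + 1) FF.
- near=> f; have -> : f = f1 - (f1 - f) by rewrite opprB addrC subrK.
  rewrite (le_trans (ler_normB _ _))// lerD2l ltW//; near: f; exact: f1P.
- move=> x; apply: R_complete; apply/cauchyP => e e0.
  have [f fP] := Fc (e / (`|x| + 1)) (divr_gt0 e0 (ltr_wpDl (normr_ge0 x) ltr01)).
  exists (f x); apply: filterS fP => g fg; rewrite /= -ball_normE /=.
  have -> : f x - g x = (f - g) x by [].
  apply: le_lt_trans (dual_ler_norm _ _) _.
  move: fg; rewrite ltr_pdivlMr ?ltr_wpDl//; apply: le_lt_trans.
  by rewrite ler_wpM2l// lerDl.
apply/cvg_ex; exists l; apply/cvgrPdist_le => e e0.
have [f fP] := Fc (e / 2) (divr_gt0 e0 (ltr0Sn _ 1)).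
have lf : `|l - f| <= e / 2.
  apply: dual_norm_le => x x1.
  have cL : `|(g : dual V) x - f x| @[g --> F] --> `|l x - f x|.
    by apply: cvg_norm; apply: cvgB (Fl x) _; exact: cvg_cst.
  have <- : lim (`|(g : dual V) x - f x| @[g --> F]) = `|(l - f) x|.
    exact: (cvg_lim _ cL).
  apply: limr_le; first by apply/cvg_ex; eexists; exact: cL.
  near=> g; have -> : g x - f x = - ((f - g) x) by rewrite opprB.
  rewrite normrN (le_trans (dual_ler_norm _ _))//.
  rewrite -[leRHS]mulr1 ler_pM// ltW//; near: g; exact: fP.
near=> g; have -> : l - g = (l - f) + (f - g) by rewrite addrA subrK.
rewrite (le_trans (ler_normD _ _))// [leRHS]splitr lerD//.
by rewrite ltW//; near: g; exact: fP.
Unshelve. all: by end_near. Qed.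

End dual_complete.

HB.instance Definition _ (R : realType) (V : normedModType R) :=
  Uniform_isComplete.Build (dual V) (@dual_complete R V).

(** * Reflexive spaces have property (K) *)

Section reflexive_property_K.
Context {R : realType}.

(** The evaluations at points of [K] are pointwise bounded on [dual X], since each functional maps
    [K] onto a compact set of scalars; uniform boundedness and the isometry of the embedding
    conclude. *)
Lemma weakly_compact_bounded (X : normedModType R) (K : set X) :
  weakly_compact K -> exists M, forall x, K x -> `|x| <= M.
Proof.
move=> wK; pose F := [set (bidual_eval x : dual X -> R^o) | x in K].
have [||M FM] := @Banach_Steinhauss R (dual X) R^o F _ _ 1.
- move=> _ [x Kx <-]; split; last exact: dual_linear.
  move=> r; exists (`|x| * r) => f fr; rewrite (le_trans (dual_ler_norm _ _))//.
  by rewrite bidual_eval_norm ler_wpM2l.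
- move=> f; have cf : continuous (f : weak X -> R^o).
    by move=> x; have [+ _] := weak_cvgP x (nbhs_filter (x : weak X)); apply.
  have := @continuous_compact (weak X) R^o f K (continuous_subspaceT cf) wK.
  move=> /compact_bounded[M [_ /(_ (M + 1) ltac:(by rewrite ltrDl))]] KM.
  by exists (M + 1) => _ [x Kx <-]; apply: KM; exists x.
exists M => x Kx; have [f f1 <-] := norming_functional x.
apply: le_trans (ler_norm _) _; apply: (FM (bidual_eval x)) => //.
by exists x.
Qed.

(** Supports lie in a window from [N] to [M], so that the next block can start at [M]. *)
Definition convex_combinations (V : lmodType R) (f : nat -> V) (N : nat) : set V :=
  [set v | exists (M : nat) (a : nat -> R), [/\ forall n, 0 <= a n,
    \sum_(N <= n < M) a n = 1 & v = \sum_(N <= n < M) a n *: f n]].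

Lemma convex_combinations_convex (V : lmodType R) (f : nat -> V) N :
  convex_subset (convex_combinations f N).
Proof.
(* Padding with zero coefficients brings two combinations to a common window. *)
have widen (W : lmodType R) (a : nat -> R) (h : nat -> W) M M' : (M <= M')%N ->
    \sum_(N <= n < M) a n *: h n =
    \sum_(N <= n < M') (if (n < M)%N then a n else 0) *: h n.
  move=> MM'; have [NM|MN] := leqP N M; last first.
    rewrite big_geq ?(ltnW MN)// big_nat_cond big1// => n /andP[/andP[Nn _] _].
    by rewrite ltnNge (leq_trans (ltnW MN) Nn)/= scale0r.
  rewrite [RHS](big_cat_nat NM MM') /= [X in _ = _ + X]big_nat_cond.
  rewrite [X in _ = _ + X]big1 ?addr0; last first.
    by move=> n /andP[/andP[Mn _] _]; rewrite ltnNge Mn/= scale0r.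
  by apply: eq_big_nat => n /andP[_ ->].
have widen1 (a : nat -> R) M M' : (M <= M')%N -> \sum_(N <= n < M) a n =
    \sum_(N <= n < M') (if (n < M)%N then a n else 0).
  move=> MM'; have := widen R^o a (fun=> 1) _ _ MM'.
  by under eq_bigr do rewrite [_ *: _]mulr1; under [RHS]eq_bigr do rewrite [_ *: _]mulr1.
move=> s t _ _ s0 t0 st [M [a [a0 a1 ->]]] [M' [a' [a'0 a'1 ->]]].
exists (maxn M M'), (fun n => s * (if (n < M)%N then a n else 0) +
  t * (if (n < M')%N then a' n else 0)); split.
- by move=> n; rewrite addr_ge0// mulr_ge0//; case: ifP.
- rewrite big_split /= -!mulr_sumr -!widen1 ?leq_maxl ?leq_maxr//.
  by rewrite a1 a'1 !mulr1.
- rewrite (widen _ _ _ _ _ (leq_maxl M M')) (widen _ _ _ _ _ (leq_maxr M M')).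
  rewrite !scaler_sumr -big_split/=; apply: eq_bigr => n _.
  by rewrite scalerDl !scalerA.
Qed.

(** If [l] were at distance at least [e] from the convex combinations, a separating [phi] would
    satisfy [phi l + e <= phi (f n)] for all [n >= N], against weak convergence. *)
Lemma mazur (V : normedModType R) (f : nat -> V) (l : V) :
  (forall phi : dual V, phi (f n) @[n --> \oo] --> phi l) ->
  forall N e, 0 < e -> exists2 c, convex_combinations f N c & `|c - l| < e.
Proof.
move=> fl N e e0; apply: contrapT => nc.
have fN n : (N <= n)%N -> convex_combinations f N (f n).
  move=> Nn; exists n.+1, (fun m => (m == n)%:R); split=> //.
    by rewrite big_nat_recr//= eqxx big_nat_cond big1 ?add0r// => i /andP[/andP[_ /ltn_eqF->]].
  rewrite big_nat_recr//= eqxx scale1r big_nat_cond big1 ?add0r// => i.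
  by move=> /andP[/andP[_ /ltn_eqF->]]; rewrite scale0r.
have [|||phi _ phiP] := @separation _ _ (convex_combinations f N) l e.
- exact: convex_combinations_convex.
- by exists (f N); exact: fN.
- by move=> c Cc; rewrite leNgt; apply/negP => ce; apply: nc; exists c.
have : phi l + e <= phi l.
  rewrite -[leRHS](cvg_lim _ (fl phi))//; apply: limr_ge.
    by apply/cvg_ex; exists (phi l); exact: fl.
  by exists N => // n /= Nn; exact/phiP/fN.
lra.
Qed.

(** Mazur's lemma is applied with tolerance [1 / (k + 1)] to the tail that starts where block
    [k - 1] ended. *)
Lemma mazur_blocks (V : normedModType R) (f : nat -> V) (l : V) :
  (forall phi : dual V, phi (f n) @[n --> \oo] --> phi l) ->
  exists2 g, convex_block_subsequence f g & g @ \oo --> l.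
Proof.
move=> fl.
have /choice[c cP] (Nk : nat * nat) : exists Ma : nat * (nat -> R),
    [/\ forall n, 0 <= Ma.2 n, \sum_(Nk.1 <= n < Ma.1) Ma.2 n = 1 &
    `|\sum_(Nk.1 <= n < Ma.1) Ma.2 n *: f n - l| < Nk.2.+1%:R^-1].
  have [_ [M [a [a0 a1 ->]]] al] :=
    mazur fl Nk.1 (ltac:(by rewrite invr_gt0) : 0 < Nk.2.+1%:R^-1 :> R).
  by exists (M, a).
pose N := fix N k := if k is k'.+1 then (c (N k', k')).1 else 0%N.
pose ak k := (c (N k, k)).2.
(* Coefficients with sum 1 need a nonempty window. *)
have Nlt k : (N k < N k.+1)%N.
  rewrite ltnNge; apply/negP => NN; have [_ + _] := cP (N k, k).
  by rewrite big_geq//= => /esym/eqP; rewrite oner_eq0.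
have Nmono : {homo N : m n / (m <= n)%N}.
  by apply: homo_leq => // [n|k]; [exact: leq_trans|exact: ltnW].
(* A block subsequence uses one coefficient sequence for all blocks. The windows are disjoint, so
   [n] determines its block. *)
have /choice[a aP] n : exists v : R, 0 <= v /\
    forall k, (N k <= n < N k.+1)%N -> v = ak k n.
  have [[k kn]|nk] := pselect (exists k, (N k <= n < N k.+1)%N); last first.
    by exists 0; split=> // k kn; case: nk; exists k.
  exists (ak k n); split; first by have [+ _ _] := cP (N k, k); exact.
  move=> k' k'n; congr (ak _ n); apply/eqP; rewrite eqn_leq.
  move: kn k'n => /andP[k1 k2] /andP[k'1 k'2]; apply/andP; split; rewrite leqNgt.
    apply/negP => /Nmono h; have := leq_trans k'2 (leq_trans h k1).
    by rewrite ltnn.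
  apply/negP => /Nmono h; have := leq_trans k2 (leq_trans h k'1).
  by rewrite ltnn.
pose I k := [fset n | n in index_iota (N k) (N k.+1)]%fset.
have inI k n : (n \in I k) = (N k <= n < N k.+1)%N.
  by rewrite in_fset /= mem_index_iota.
have sumI (W : nmodType) (h : nat -> W) k :
    \sum_(n <- I k) h n = \sum_(N k <= n < N k.+1) h n.
  apply: perm_big; apply: uniq_perm; rewrite ?fset_uniq ?iota_uniq// => n.
  by rewrite mem_index_iota -inI.
exists (fun k => \sum_(n <- I k) a n *: f n).
  exists I, a; split=> //.
  - move=> k m n; rewrite !inI => /andP[_ mk] /andP[kn _].
    exact: leq_trans mk kn.
  - by move=> n; case: (aP n).
  - move=> k; rewrite sumI; have [_ <- _] := cP (N k, k).
    by apply: eq_big_nat => n kn; rewrite ((aP n).2 k kn).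
apply/cvgrPdist_lt => e e0; have [k0 _ k0P] := near_infty_natSinv_lt (PosNum e0).
exists k0 => // k /= /k0P; apply: lt_trans; rewrite distrC sumI.
have [_ _] := cP (N k, k); congr (`|_ - _| < _).
by apply: eq_big_nat => n kn; rewrite ((aP n).2 k kn).
Qed.

Lemma reflexive_property_K (X : normedModType R) :
  reflexive_space X -> property_K X.
Proof.
move=> refl f [l /weak_star_cvgP fl].
have [phi|g fg gl] := @mazur_blocks _ f l.
  have [x _ <-] : range (@bidual_eval _ X) phi by rewrite refl.
  exact: fl.
exists g => //; exists l; apply/mackey_cvgP => K wK e e0.
have [M KM] := weakly_compact_bounded wK.
have M1 : 0 < `|M| + 1 by rewrite ltr_wpDl.
move/cvgrPdist_lt : gl => /(_ _ (divr_gt0 e0 M1)) [n0 _ n0P].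
exists n0 => // n /= /n0P; rewrite ltr_pdivlMr// distrC => gle x Kx.
have -> : g n x - l x = (g n - l) x by [].
apply: le_lt_trans (dual_ler_norm _ _) (le_lt_trans _ gle).
rewrite ler_wpM2l// (le_trans (KM _ Kx))// (le_trans (ler_norm M))//.
by rewrite lerDl.
Qed.

End reflexive_property_K.

(** * Copies of l1 *)

Section ell1_theory.
Context {R : realType}.

Lemma ell1_norm_ge (u : ell1 R) n : \sum_(0 <= i < n) `|u i| <= `|u|.
Proof. exact/abs_summable_le_lim/ell1_summable. Qed.

Lemma ell1_norm_le (u : ell1 R) (M : R) :
  (forall n, \sum_(0 <= i < n) `|u i| <= M) -> `|u| <= M.
Proof.
by move=> uM; apply: limr_le; [exact: ell1_summable|exact: nearW].
Qed.

Lemma ell1_coord (u : ell1 R) n : `|u n| <= `|u|.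
Proof.
apply: le_trans (ell1_norm_ge u n.+1).
by rewrite big_nat_recr//= lerDr sumr_ge0.
Qed.

Lemma ell1_of_bounded (u : nat -> R^o) (M : R) :
  (forall n, \sum_(0 <= i < n) `|u i| <= M) ->
  exists e : ell1 R, forall n, e n = u n.
Proof.
move=> uM; suff su : u \in @abs_summable R by exists (Ell1 su).
exact/asboolP/(abs_summable_bound uM).
Qed.

Lemma cvg_sum_nat (T : Type) (F : set_system T) (h : T -> nat -> R^o) (k : nat -> R^o) n :
  Filter F -> (forall i, h t i @[t --> F] --> k i) ->
  \sum_(0 <= i < n) h t i @[t --> F] --> \sum_(0 <= i < n) k i.
Proof.
move=> FF hk; elim: n => [|n IH].
  by rewrite big_geq//; under eq_fun do rewrite big_geq//; exact: cvg_cst.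
by rewrite big_nat_recr//=; under eq_fun do rewrite big_nat_recr//=; exact: cvgD.
Qed.

(** Limits are taken coordinatewise; the Cauchy estimate passes to the limit in each partial sum.
    This gives closedness of the range in [contains_ell1]. *)
Lemma ell1_complete (F : set_system (ell1 R)) :
  ProperFilter F -> cauchy F -> cvg F.
Proof.
move=> FF /cauchyP Fc.
have {}Fc e : 0 < e -> exists f : ell1 R, \forall g \near F, `|f - g| < e.
  by move=> /Fc[f Ff]; exists f; move: Ff; rewrite -ball_normE.
have Fcvg n : cvg ((f : ell1 R) n @[f --> F]).
  apply: R_complete; apply/cauchyP => e e0.
  have [f fP] := Fc e e0; exists (f n); apply: filterS fP => g fg.
  by rewrite /= -ball_normE /=; apply: le_lt_trans (ell1_coord (f - g) n) fg.
pose l n : R^o := lim ((f : ell1 R) n @[f --> F]).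
have Fl n : (f : ell1 R) n @[f --> F] --> l n by exact: Fcvg.
have lB (f : ell1 R) e n : (\forall g \near F, `|f - g| < e) ->
    \sum_(0 <= i < n) `|l i - f i| <= e.
  move=> fe.
  have cl : \sum_(0 <= i < n) `|(g : ell1 R) i - f i| @[g --> F] -->
      (\sum_(0 <= i < n) `|l i - f i| : R^o).
    apply: (@cvg_sum_nat _ F (fun g i => `|(g : ell1 R) i - f i|)
      (fun i => `|l i - f i|)) => i.
    by apply: cvg_norm; apply: cvgB (Fl i) _; exact: cvg_cst.
  rewrite -(cvg_lim (@norm_hausdorff _ _) cl); apply: limr_le.
    by apply/cvg_ex; eexists; exact: cl.
  apply: filterS fe => g fg; rewrite (le_trans _ (ltW fg))//.
  rewrite (le_trans _ (ell1_norm_ge (f - g) n))//.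
  by apply: ler_sum => i _; rewrite distrC.
have [f1 f1P] := Fc 1 ltr01.
have [|u uE] := @ell1_of_bounded l (1 + `|f1|).
  move=> n; apply: le_trans (lerD (lB _ _ n f1P) (ell1_norm_ge f1 n)).
  rewrite -big_split/=; apply: ler_sum => i _.
  by rewrite (le_trans _ (ler_normD _ _))// subrK.
apply/cvg_ex; exists u; apply/cvgrPdist_le => e e0.
have [f fP] := Fc (e / 2) (divr_gt0 e0 (ltr0Sn _ 1)).
have uf : `|u - f| <= e / 2.
  apply: ell1_norm_le => n; apply: le_trans (lB _ _ n fP).
  by apply: ler_sum => i _; rewrite -uE.
apply: filterS fP => g fg; have -> : u - g = (u - f) + (f - g) by rewrite addrA subrK.
by rewrite (le_trans (ler_normD _ _))// [leRHS]splitr lerD// ltW.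
Qed.

(** The operator sends [u] to the sum of the series of [u i *: x i]. The lower estimate on finite
    sums bounds it below by [d], so its inverse is continuous and its range closed. *)
Lemma contains_ell1 (X : completeNormedModType R) (x : nat -> X) (d : R) :
  0 < d -> (forall n, `|x n| <= 1) ->
  (forall n (c : nat -> R), d * \sum_(0 <= i < n) `|c i| <=
     `|\sum_(0 <= i < n) c i *: x i|) ->
  contains_isomorphic_subspace X (ell1 R).
Proof.
move=> d0 x1 xd.
pose s (u : ell1 R) : nat -> X := series (fun i => u i *: x i).
have s_le u n : `|s u n| <= `|u|.
  rewrite (le_trans (ler_norm_sum _ _ _))// (le_trans _ (ell1_norm_ge u n))//.
  by apply: ler_sum => i _; rewrite /= normrZ ler_piMr.
have s_cvg u : cvgn (s u).
  apply: normed_cvg; apply: nondecreasing_is_cvgn.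
    exact: (@nondecreasing_series R (fun n => `|u n *: x n|) xpredT 0).
  exists `|u| => _ [n _ <-]; rewrite (le_trans _ (ell1_norm_ge u n))//.
  by apply: ler_sum => i _; rewrite /= normrZ ler_piMr.
pose T0 u := limn (s u).
have sT u : s u @ \oo --> T0 u by exact: s_cvg.
have T_lin : linear T0.
  move=> a u v; apply: (@cvg_lim _ (@norm_hausdorff _ _)).
  have -> : s (a *: u + v) = (fun n => a *: s u n + s v n).
    apply/funext => n; rewrite /s /series /= scaler_sumr -big_split /=.
    apply: eq_bigr => i _; rewrite scalerA -scalerDl; congr (_ *: _).
  by apply: cvgD (sT v); apply: cvgZl_tmp; exact: sT.
pose L := GRing.isLinear.Build R (ell1 R) X _ _ T_lin.
pose T : {linear ell1 R -> X} := HB.pack T0 L.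
have T_le u : `|T u| <= `|u|.
  have cn : `|s u n| @[n --> \oo] --> `|T u| by apply: cvg_norm; exact: sT.
  rewrite -(cvg_lim (@norm_hausdorff _ _) cn); apply: limr_le.
    by apply/cvg_ex; eexists; exact: cn.
  exact: nearW.
have T_ge u : d * `|u| <= `|T u|.
  rewrite -ler_pdivlMl//; apply: ell1_norm_le => n; rewrite ler_pdivlMl//.
  have cn : `|s u n| @[n --> \oo] --> `|T u| by apply: cvg_norm; exact: sT.
  rewrite -(cvg_lim (@norm_hausdorff _ _) cn); apply: limr_ge.
    by apply/cvg_ex; eexists; exact: cn.
  exists n => // m /= nm; apply: le_trans (xd m u); rewrite ler_wpM2l ?(ltW d0)//.
  by rewrite (big_cat_nat (leq0n n) nm)/= lerDl sumr_ge0.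
have T_cont : continuous T.
  apply: bounded_linear_continuous; apply/bounded_funP => r.
  by exists r => u ur; exact: le_trans (T_le u) ur.
have T_dist u v : `|u - v| <= `|T u - T v| / d.
  by rewrite ler_pdivlMr// mulrC -linearB.
have /choice[S SP] y : exists u, range T y -> T u = y.
  have [[u _ <-]|ny] := pselect (range T y); first by exists u.
  by exists 0.
have SK y : range T y -> T (S y) = y by exact: SP.
exists (range T).
  split.
  - move=> y /=.
    (* A filter on the range converging to [y] is pulled back to l1, where the lower bound makes it
       Cauchy; its limit is mapped to [y]. *)
    rewrite closureEcvg => -[G GF [Gy YG]].
    pose H := filter_from G (fun A => T @^-1` A).
    have HF : ProperFilter H.
      apply: filter_from_proper.
        apply: filter_from_filter; first by exists setT; exact: filterT.
        by move=> A B GA GB; exists (A `&` B) => //; exact: filterI.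
      move=> A GA; have : G (A `&` range T) by apply: filterI => //; exact: YG.
      by move=> /filter_ex[z [Az [u _ uz]]]; exists u; move: Az; rewrite -uz.
    have Hcau : cauchy H.
      apply/cauchyP => e e0.
      have de0 : 0 < d * e / 2 by rewrite divr_gt0// mulr_gt0.
      have Ge : G (ball y (d * e / 2)) by apply: Gy; exact: nbhsx_ballx.
      have /filter_ex[z [yz [u _ uz]]] : G (ball y (d * e / 2) `&` range T).
        by apply: filterI => //; exact: YG.
      exists u; exists (ball y (d * e / 2)) => // v /= yv.
      rewrite -ball_normE /=; apply: le_lt_trans (T_dist _ _) _.
      rewrite ltr_pdivrMr// mulrC [ltRHS]splitr uz.
      have -> : z - T v = (z - y) + (y - T v) by rewrite addrA subrK.
      apply: le_lt_trans (ler_normD _ _) _; apply: ltrD.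
        by move: yz; rewrite -ball_normE /= distrC.
      by move: yv; rewrite -ball_normE.
    have /cvg_ex[u Hu] := ell1_complete HF Hcau.
    exists u => //; apply: (@cvg_unique _ (@norm_hausdorff _ X) (T @ H)).
    + exact: (cvg_comp _ _ Hu (T_cont u)).
    + move=> A /Gy GA; exists A => //.
  - by exists 0 => //; rewrite linear0.
  - move=> a _ _ [u _ <-] [v _ <-]; exists (a *: u + v) => //.
    by rewrite linearD linearZ.
exists T, S; split=> //.
- apply/subspace_continuousP => y Yy; apply/cvgrPdist_lt => e e0.
  have de0 : 0 < d * e by rewrite mulr_gt0.
  have : nbhs y (ball y (d * e)) by exact: nbhsx_ballx.
  move=> yb; rewrite near_withinE; near=> z => Yz.
  have := T_dist (S y) (S z); rewrite !SK// => /le_lt_trans; apply.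
  rewrite ltr_pdivrMr// mulrC.
  have : ball y (d * e) z by near: z.
  by rewrite -ball_normE.
- move=> u; apply/eqP; rewrite -subr_eq0 -normr_le0.
  apply: le_trans (T_dist _ _) _; rewrite SK; last by exists u.
  by rewrite subrr normr0 mul0r.
Unshelve. all: by end_near. Qed.

End ell1_theory.

(** * Independent sequences from dyadic trees of sets *)

Section independence.
Context {S W : Type} (A : W -> bool -> set S) (P : W -> Prop).
Variable good : forall I : finType, (I -> set S) -> Prop.

Definition refinement (I : finType) (K : I -> set S) (w : W) :
  (I * bool)%type -> set S := fun ib => K ib.1 `&` A w ib.2.

(** Iterated refinement splits every set of a level in two; the pattern [theta] selects a branch,
    and nonemptiness at level [n] gives the witness. The predicate [good] stands for the invariant,
    which differs between the two applications. *)
Lemma independent_sequence (I0 : finType) (K0 : I0 -> set S) (i0 : I0) :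
  good K0 ->
  (forall (I : finType) (K : I -> set S), good K -> forall i, K i !=set0) ->
  (forall (I : finType) (K : I -> set S), good K ->
    exists2 w, P w & good (refinement K w)) ->
  exists2 w : nat -> W, forall n, P (w n) & forall (theta : nat -> bool) n,
    exists2 s, exists i, K0 i s & forall j, (j < n)%N -> A (w j) (theta j) s.
Proof.
move=> good0 good_ne good_ref.
(* The index type doubles at each level, so a level carries its type. *)
pose node := {I : finType & I -> set S}.
have [w0 _ _] := good_ref _ _ good0.
have /choice[F FP] (N : node) :
    exists w, good (projT2 N) -> P w /\ good (refinement (projT2 N) w).
  have [gN|ngN] := pselect (good (projT2 N)); last by exists w0.
  by have [w Pw gw] := good_ref _ _ gN; exists w.
pose next (N : node) : node :=
  existT (fun I : finType => I -> set S) _ (refinement (projT2 N) (F N)).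
pose N n : node := iter n next (existT (fun I : finType => I -> set S) _ K0).
have goodN n : good (projT2 (N n)).
  by elim: n => [//|n /FP[]].
exists (fun n => F (N n)) => [n|theta n]; first by case: (FP _ (goodN n)).
have [i iP] : exists i : projT1 (N n), projT2 (N n) i `<=` [set s |
    (exists i, K0 i s) /\ forall j, (j < n)%N -> A (F (N j)) (theta j) s].
  elim: n => [|n [i iP]]; first by exists i0 => s K0s; split=> //; exists i0.
  exists (i, theta n) => s [/= /iP[s0 sj] As]; split=> // j.
  by rewrite ltnS leq_eqVlt => /predU1P[->|/sj].
by have [s /iP[s0 sj]] := good_ne _ _ (goodN n) i; exists s.
Qed.

End independence.

(* Along a sign pattern and its opposite, the difference of the two witnessing
   functionals is at least [d] times the sign at every vector. *)
Lemma independent_contains_ell1 (R : realType) (X : completeNormedModType R)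
    (d : R) (good : forall I : finType, (I -> set (dual X)) -> Prop) :
  0 < d ->
  good unit (fun=> [set f | `|f| <= 1]) ->
  (forall (I : finType) (K : I -> set (dual X)), good I K ->
    forall i, K i !=set0) ->
  (forall (I : finType) (K : I -> set (dual X)), good I K ->
    exists (x : X) (hi lo : R), [/\ `|x| <= 1, lo + d <= hi &
      good _ (fun ib : I * bool => K ib.1 `&`
        [set f | if ib.2 then hi <= f x else f x <= lo])]) ->
  contains_isomorphic_subspace X (ell1 R).
Proof.
move=> d0 good0 good_ne good_ref.
pose A (w : X * R * R) (b : bool) : set (dual X) :=
  [set f | if b then w.1.2 <= f w.1.1 else f w.1.1 <= w.2].
have [I K gK|w wP wA] := @independent_sequence _ _ A
  (fun w => `|w.1.1| <= 1 /\ w.2 + d <= w.1.2) good _ _ tt good0 good_ne.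
  by have [x [hi [lo [x1 lohi gKx]]]] := good_ref _ _ gK; exists (x, hi, lo).
(* The two witnesses lie in the unit ball, so [f v - g v] is at most twice [|v|]: hence the half of
   [d]. *)
apply: (@contains_ell1 _ _ (fun n => (w n).1.1) (d / 2)); first by rewrite divr_gt0.
  by move=> n; case: (wP n).
move=> n c; set v := \sum_(0 <= i < n) c i *: _.
have [f [_ f1] fA] := wA (fun i => 0 <= c i) n.
have [g [_ g1] gA] := wA (fun i => ~~ (0 <= c i)) n.
have : d * \sum_(0 <= i < n) `|c i| <= f v - g v.
  have vE (h : dual X) : h v = \sum_(0 <= i < n) c i * h (w i).1.1.
    by rewrite linear_sum; apply: eq_bigr => i _; rewrite linearZ.
  rewrite !vE -sumrB mulr_sumr; apply: ler_sum_nat => i /= ni; rewrite -mulrBr.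
  have [_ wd] := wP i; have := fA i ni; have := gA i ni; rewrite /A /=.
  case: (leP 0 (c i)) => /= ci gi fi.
    rewrite ger0_norm// mulrC ler_wpM2l//; lra.
  rewrite ltr0_norm// mulrC -subr_ge0.
  have -> : c i * (f (w i).1.1 - g (w i).1.1) - - c i * d =
    - c i * (g (w i).1.1 - f (w i).1.1 - d) by ring.
  by rewrite mulr_ge0; lra.
have fv : f v <= `|v|.
  by rewrite (le_trans (ler_norm _))// (le_trans (dual_ler_norm _ _))// ler_piMl.
have gv : - g v <= `|v|.
  rewrite (le_trans (ler_norm _))// normrN (le_trans (dual_ler_norm _ _))//.
  by rewrite ler_piMl.
rewrite -mulrA mulrCA; lra.
Qed.

(** * Bourgain's theorem *)

Section tail_hull.
Context {R : realType} {V : lmodType R}.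
Implicit Types (f g h : nat -> V) (C : set V).

(** The convex hull as an intersection: a convex property of all terms from [N] on passes to a
    member by mere application. *)
Definition tail_hull f N : set V := [set v | forall C, convex_subset C ->
  (forall n, (N <= n)%N -> C (f n)) -> C v].

(* Weaker than [convex_block_subsequence]: supports may overlap, which makes the
   relation transitive and compatible with diagonal extraction at no cost. *)
Definition tail_convex h g := forall k, tail_hull g k (h k).

Lemma tail_hull_convex f N : convex_subset (tail_hull f N).
Proof.
move=> a b x y a0 b0 ab fx fy C cC Cf.
by apply: (cC) => //; [exact: fx|exact: fy].
Qed.

Lemma tail_hull_mem f N n : (N <= n)%N -> tail_hull f N (f n).
Proof. by move=> Nn C _; exact. Qed.

Lemma tail_hull_sub f N g M : (forall n, (M <= n)%N -> tail_hull f N (g n)) ->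
  tail_hull g M `<=` tail_hull f N.
Proof. by move=> gf v; apply => //; exact: tail_hull_convex. Qed.

Lemma tail_hull_le f N M : (N <= M)%N -> tail_hull f M `<=` tail_hull f N.
Proof.
by move=> NM; apply: tail_hull_sub => n Mn; exact: tail_hull_mem (leq_trans NM Mn).
Qed.

Lemma tail_convex_hull h g N : tail_convex h g -> tail_hull h N `<=` tail_hull g N.
Proof.
by move=> hg; apply: tail_hull_sub => n Nn; exact: tail_hull_le Nn _ (hg n).
Qed.

Lemma tail_convex_refl f : tail_convex f f.
Proof. by move=> k; exact: tail_hull_mem. Qed.

Lemma tail_convex_trans g h f : tail_convex h g -> tail_convex g f -> tail_convex h f.
Proof. by move=> hg gf k; exact: (tail_convex_hull gf (hg k)). Qed.

Lemma tail_convex_shift h g n : tail_convex h g ->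
  tail_convex (fun k => h (k + n)%N) g.
Proof. by move=> hg k; apply: tail_hull_le (hg (k + n)%N); exact: leq_addr. Qed.

Lemma convex_sum C (I : eqType) (s : seq I) (a : I -> R) (z : I -> V) :
  convex_subset C -> (forall i, 0 <= a i) -> (forall i, i \in s -> C (z i)) ->
  \sum_(i <- s) a i = 1 -> C (\sum_(i <- s) a i *: z i).
Proof.
move=> cC a0 Cz a1.
(* The induction needs normalised sums, because the weights of a shorter list no longer add up to
   1. *)
suff : 0 < \sum_(i <- s) a i ->
    C ((\sum_(i <- s) a i)^-1 *: \sum_(i <- s) a i *: z i).
  by rewrite a1 invr1 scale1r; apply.
elim: s Cz {a1} => [|i s IH] Cz; first by rewrite big_nil ltxx.
rewrite !big_cons; set t := \sum_(j <- s) a j; set v := \sum_(j <- s) _ => ait.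
have Czi : C (z i) by apply: Cz; rewrite mem_head.
have [t0|t0] := eqVneq t 0.
  have -> : v = 0.
    rewrite /v big_seq big1// => j js; suff -> : a j = 0 by rewrite scale0r.
    apply/eqP; rewrite eq_le a0 andbT -t0 /t (perm_big _ (perm_to_rem js)) big_cons.
    by rewrite lerDl sumr_ge0.
  move: ait; rewrite t0 !addr0 => ai; rewrite scalerA mulVf ?gt_eqF//.
  by rewrite scale1r.
have t_gt0 : 0 < t by rewrite lt_def t0 sumr_ge0.
have -> : (a i + t)^-1 *: (a i *: z i + v) =
    ((a i + t)^-1 * a i) *: z i + ((a i + t)^-1 * t) *: (t^-1 *: v).
  by rewrite !scalerA mulfK// scalerDr scalerA.
apply: cC => //; rewrite ?mulr_ge0 ?invr_ge0 ?(ltW ait) ?(ltW t_gt0)//.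
  by rewrite -mulrDr mulVf// gt_eqF.
by apply: IH => // j js; apply: Cz; rewrite in_cons js orbT.
Qed.

Lemma convex_average C (I : finType) (z : I -> V) : convex_subset C ->
  (0 < #|I|)%N -> (forall i, C (z i)) -> C (#|I|%:R^-1 *: \sum_i z i).
Proof.
move=> cC I0 Cz; rewrite scaler_sumr; apply: convex_sum => //.
have sum_cst (c : R) : \sum_(i : I) c = #|I|%:R * c.
  by rewrite -sum1_card natr_sum mulr_suml; apply: eq_bigr => i _; rewrite mul1r.
by rewrite sum_cst mulfV// pnatr_eq0 -lt0n.
Qed.

(** Blocks are nonempty and successive, so block [k] lies in the indices from [k] on. *)
Lemma block_tail_convex (x y : nat -> V) :
  convex_block_subsequence x y -> tail_convex y x.
Proof.
move=> [I [a [I_incr a0 a1 yE]]].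
have Ige k n : n \in I k -> (k <= n)%N.
  elim: k n => [//|k IH] n In.
  have [m Im] : exists m, m \in I k.
    apply: contrapT => /forallNP Ik; have := a1 k.
    rewrite big_seq big1 => [/esym/eqP|m /Ik//].
    by rewrite oner_eq0.
  exact: leq_ltn_trans (IH _ Im) (I_incr _ _ _ Im In).
move=> k; rewrite yE; apply: convex_sum => //; first exact: tail_hull_convex.
by move=> n /Ige; exact: tail_hull_mem.
Qed.

End tail_hull.

(** * Oscillation of sequences of functionals *)

Section oscillation.
Context {R : realType} {X : normedModType R}.
Implicit Types (f g h : nat -> dual X) (d : R).

(** The index [N] depends on [x], so that oscillation 0 means pointwise convergence, not convergence
    in norm. *)
Definition osc_le h d := forall (x : X), `|x| <= 1 -> forall e, 0 < e ->
  exists N, forall m n, (N <= m)%N -> (N <= n)%N -> `|h m x - h n x| <= d + e.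

Lemma osc_leW h d d' : d <= d' -> osc_le h d -> osc_le h d'.
Proof.
move=> dd' hd x x1 e e0; have [N NP] := hd x x1 e e0.
by exists N => m n Nm Nn; have := NP m n Nm Nn; lra.
Qed.

Lemma osc_le_ge0 h d : osc_le h d -> 0 <= d.
Proof.
move=> hd; apply/ler_addgt0Pr => e e0.
have [|N NP] := hd 0 _ e e0; first by rewrite normr0.
exact: le_trans (NP N N (leqnn _) (leqnn _)).
Qed.

Lemma osc_le_inf h d : (forall e, 0 < e -> osc_le h (d + e)) -> osc_le h d.
Proof.
move=> hd x x1 e e0; have e20 : 0 < e / 2 by rewrite divr_gt0.
have [N NP] := hd _ e20 x x1 _ e20.
by exists N => m n Nm Nn; have := NP m n Nm Nn; lra.
Qed.

(** The estimate is convex in each variable separately, and passes to the hull in one variable at a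
    time. *)
Lemma tail_hull_osc g N (x : X) c :
  (forall m n, (N <= m)%N -> (N <= n)%N -> `|g m x - g n x| <= c) ->
  forall u v, tail_hull g N u -> tail_hull g N v -> `|u x - v x| <= c.
Proof.
have conv (v : dual X) : convex_subset [set u : dual X | `|u x - v x| <= c].
  move=> a b u w a0 b0 ab /= ux wx.
  have -> : (a *: u + b *: w) x - v x = a * (u x - v x) + b * (w x - v x).
    have -> : (a *: u + b *: w) x = a * u x + b * w x by [].
    by rewrite -[v x in LHS]mul1r -ab; ring.
  rewrite (le_trans (ler_normD _ _))// !normrM (ger0_norm a0) (ger0_norm b0).
  by rewrite -[c]mul1r -ab mulrDl lerD// ler_wpM2l.
move=> gc u v gu gv; apply: (gu _ (conv v)) => n Nn /=; rewrite distrC.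
by apply: (gv _ (conv (g n))) => m Nm /=; exact: gc.
Qed.

Lemma osc_le_tail_convex h g d : tail_convex h g -> osc_le g d -> osc_le h d.
Proof.
move=> hg gd x x1 e e0; have [N NP] := gd x x1 e e0.
exists N => m n Nm Nn; apply: (tail_hull_osc NP).
  exact: tail_hull_le Nm _ (hg m).
exact: tail_hull_le Nn _ (hg n).
Qed.

Lemma osc_le_shift h d n : osc_le (fun k => h (k + n)%N) d -> osc_le h d.
Proof.
move=> hd x x1 e e0; have [N NP] := hd x x1 e e0.
exists (N + n)%N => p q Np Nq.
have := NP (p - n)%N (q - n)%N; rewrite !subnK ?(leq_trans (leq_addl _ _) Np)//.
  by apply; lia.
by rewrite (leq_trans (leq_addl _ _) Nq).
Qed.

Lemma unit_ball_convex : convex_subset [set f : dual X | `|f| <= 1].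
Proof.
move=> a b f g a0 b0 ab /= f1 g1.
rewrite (le_trans (ler_normD _ _))// !normrZ !ger0_norm//.
by have := ler_wpM2l a0 f1; have := ler_wpM2l b0 g1; lra.
Qed.

Lemma tail_convex_ball h f : tail_convex h f -> (forall n, `|f n| <= 1) ->
  forall n, `|h n| <= 1.
Proof. by move=> hf f1 n; apply: (hf n _ unit_ball_convex) => k _ /=. Qed.

Lemma osc_le_ball h : (forall n, `|h n| <= 1) -> osc_le h 2.
Proof.
move=> h1 x x1 e e0; exists 0%N => m n _ _.
rewrite (le_trans (ler_normB _ _))//.
by have := dual_le_ball (h1 m) x1; have := dual_le_ball (h1 n) x1; lra.
Qed.

(* Diagonalizing over successive near-minimizers of the oscillation. *)
Lemma osc_stable f : (forall n, `|f n| <= 1) ->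
  exists2 g, tail_convex g f &
    forall h d, tail_convex h g -> osc_le h d -> osc_le g d.
Proof.
move=> f1.
have /choice[F FP] (gn : (nat -> dual X) * nat) : exists g', tail_convex gn.1 f ->
    tail_convex g' gn.1 /\ forall h d, tail_convex h gn.1 -> osc_le h d ->
      osc_le g' (d + gn.2.+1%:R^-1).
  case: gn => g n /=.
  have [gf|ngf] := pselect (tail_convex g f); last by exists g.
  pose D := [set d | exists2 h, tail_convex h g & osc_le h d].
  have Dinf : has_inf D.
    split; last by exists 0 => d [h _ /osc_le_ge0].
    exists 2, g; first exact: tail_convex_refl.
    exact/osc_le_ball/(tail_convex_ball gf).
  have n0 : 0 < n.+1%:R^-1 :> R by rewrite invr_gt0.
  have [d [g' g'g g'd] dlt] := inf_adherent n0 Dinf.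
  exists g' => _; split=> // h d' hg hd'; apply: osc_leW g'd.
  apply: le_trans (ltW dlt) _; rewrite lerD2r.
  by apply: ge_inf; [exact: Dinf.2|exists h].
pose G := fix G n := if n is n'.+1 then F (G n', n') else f.
have Gf n : tail_convex (G n) f.
  elim: n => [|n IH]; first exact: tail_convex_refl.
  exact: tail_convex_trans (FP (G n, n) IH).1 IH.
have Gmono m n : (m <= n)%N -> tail_convex (G n) (G m).
  move=> /subnK <-; elim: (n - m)%N => [|k IH]; first exact: tail_convex_refl.
  by rewrite addSn; apply: tail_convex_trans IH; exact: (FP (G _, _) (Gf _)).1.
pose g n := G n n.
have gG n : tail_convex (fun k => g (k + n)%N) (G n).
  by move=> k; apply: tail_hull_le (Gmono n (k + n)%N _ _); rewrite ?leq_addr ?leq_addl.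
exists g => [k|h d hg hd]; first exact: Gf.
(* Shifted by [n.+1], the diagonal is tail convex in [G n.+1]; shifted by [n], [h] is a competitor
   in the infimum that [G n.+1] nearly attains. *)
apply: osc_le_inf => e e0; have [n _ /(_ n (leqnn n)) /= ne] := near_infty_natSinv_lt (PosNum e0).
apply: (@osc_leW _ (d + n.+1%:R^-1)); first by rewrite lerD2l ltW.
apply: (@osc_le_shift _ _ n.+1); apply: osc_le_tail_convex (gG n.+1) _.
apply: (FP (G n, n) (Gf n)).2 (osc_le_tail_convex (tail_convex_shift n (@tail_convex_refl _ _ h)) hd).
move=> k; apply: tail_hull_sub (hg (k + n)%N) => m km.
by rewrite -(subnK (leq_trans (leq_addl _ _) km)); apply: tail_hull_le (gG n _); lia.
Qed.

End oscillation.

(** * Irreducible oscillation yields a copy of l1 *)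

Section bourgain.
Context {R : realType} {X : completeNormedModType R}.
Implicit Types (f g h : nat -> dual X) (d : R).

Lemma not_osc_le h d : ~ osc_le h d -> exists2 x : X, `|x| <= 1 &
  forall N, exists p q, [/\ (N <= p)%N, (N <= q)%N & d < h p x - h q x].
Proof.
move=> nhd; apply: contrapT => nx; apply: nhd => x x1 e e0.
apply: contrapT => nN; apply: nx; exists x => // N; apply: contrapT => npq.
apply: nN; exists N => m n Nm Nn; rewrite leNgt; apply/negP => de.
have {}de : d < `|h m x - h n x| by rewrite (le_lt_trans _ de)// lerDl ltW.
apply: npq; have [mn|mn] := leP 0 (h m x - h n x).
  by exists m, n; split=> //; move: de; rewrite ger0_norm.
by exists n, m; split=> //; move: de; rewrite ltr0_norm// opprB.
Qed.

(* A vector almost realizing the oscillation of the average of the [z i] almost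
   realizes that of every [z i], between common levels because the oscillation
   of [g] itself is at most [d]. *)
Lemma simultaneous_oscillation g d (I : finType) (z : I -> nat -> dual X) :
  (0 < #|I|)%N -> 0 < d -> osc_le g d ->
  (forall h d', tail_convex h g -> osc_le h d' -> d <= d') ->
  (forall i, tail_convex (z i) g) ->
  exists (x : X) (hi lo : R), [/\ `|x| <= 1, lo + d / 2 <= hi &
    forall N (b : bool), exists2 n, (N <= n)%N &
      forall i, if b then hi <= z i n x else z i n x <= lo].
Proof.
move=> I0 d0 gd dmin zg; pose r : R := #|I|%:R.
have r0 : 0 < r by rewrite ltr0n.
have r1 : 1 <= r by rewrite ler1n.
(* The gap between levels loses [eta] through the choice of [x] and [8 * r * eta] through the two
   levels; [9 * r * eta] is [d / 2]. *)
pose eta := d / (18 * r).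
have dE : d = 18 * (r * eta) by rewrite /eta; field; rewrite gt_eqF.
have eta0 : 0 < eta by rewrite divr_gt0// mulr_gt0.
have reta : eta <= r * eta by rewrite ler_peMl// ltW.
pose h n := r^-1 *: \sum_i z i n.
have hg : tail_convex h g.
  move=> n; apply: convex_average => //; first exact: tail_hull_convex.
  by move=> i; exact: zg.
have hE n x : r * h n x = \sum_i z i n x.
  have -> : h n x = r^-1 * (\sum_i z i n) x by [].
  rewrite mulrA mulfV ?gt_eqF// mul1r.
  have -> : (\sum_i z i n) x = bidual_eval x (\sum_i z i n) by [].
  by rewrite linear_sum.
have [|x x1 xP] := @not_osc_le h (d - eta).
  by move=> /(dmin _ _ hg); lra.
have [N0 N0P] := gd x x1 eta eta0.
have gosc := tail_hull_osc N0P.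
have hN0 n : (N0 <= n)%N -> tail_hull g N0 (h n).
  by move=> N0n; exact: tail_hull_le N0n _ (hg n).
have zN0 i n : (N0 <= n)%N -> tail_hull g N0 (z i n).
  by move=> N0n; exact: tail_hull_le N0n _ (zg i n).
have [p [q [N0p N0q pq]]] := xP N0.
exists x, (h p x - 4 * (r * eta)), (h q x + 4 * (r * eta)); split => //; first lra.
have le_sum (w : I -> R) c : (forall i, 0 <= w i) -> \sum_i w i <= c ->
    forall i, w i <= c.
  move=> w0 wc i; apply: le_trans wc; rewrite (bigD1 i)//= lerDl.
  by apply: sumr_ge0.
have rsum (c : R) : \sum_(i : I) c = r * c.
  by rewrite sumr_const -mulr_natl.
move=> N b; have [m [n [Nm Nn mn]]] := xP (maxn N N0).
have [NNm N0m] : (N <= m)%N /\ (N0 <= m)%N by split; lia.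
have [NNn N0n] : (N <= n)%N /\ (N0 <= n)%N by split; lia.
have hpn := gosc _ _ (hN0 p N0p) (hN0 n N0n).
have hmq := gosc _ _ (hN0 m N0m) (hN0 q N0q).
move: hpn hmq; rewrite !ler_norml => /andP[_ hpn] /andP[_ hmq].
case: b; [exists m => // i|exists n => // i].
(* The quantities summed are nonnegative since all oscillations at [x] are at most [d + eta]. Their
   average is at most [4 * eta] because [h m x] is nearly maximal, so each is at most
   [4 * (r * eta)]. *)
- suff : h p x + 2 * eta - z i m x <= 4 * (r * eta) by lra.
  apply: (le_sum (fun i => h p x + 2 * eta - z i m x)) => [j|].
    have := gosc _ _ (zN0 j m N0m) (hN0 q N0q).
    by rewrite ler_norml => /andP[_]; lra.
  rewrite sumrB -hE rsum -mulrBr.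
  have -> : 4 * (r * eta) = r * (4 * eta) by ring.
  by rewrite ler_wpM2l ?(ltW r0)//; lra.
- suff : z i n x - (h q x - 2 * eta) <= 4 * (r * eta) by lra.
  apply: (le_sum (fun i => z i n x - (h q x - 2 * eta))) => [j|].
    have := gosc _ _ (hN0 p N0p) (zN0 j n N0n).
    by rewrite ler_norml => /andP[_]; lra.
  rewrite sumrB -hE rsum -mulrBr.
  have -> : 4 * (r * eta) = r * (4 * eta) by ring.
  by rewrite ler_wpM2l ?(ltW r0)//; lra.
Qed.

(** A sequence [g] whose oscillation cannot be reduced converges pointwise: if its oscillation
    [inf D] were positive, simultaneous oscillation would split every node of the tree and produce
    l1. *)
Theorem bourgain f : ~ contains_isomorphic_subspace X (ell1 R) ->
  (forall n, `|f n| <= 1) ->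
  exists2 h, tail_convex h f & exists l : weak_star X, (h : nat -> weak_star X) @ \oo --> l.
Proof.
move=> nl1 f1; have [g gf gmin] := osc_stable f1.
have g1 := tail_convex_ball gf f1.
exists g => //.
pose D := [set d | osc_le g d].
have Dinf : has_inf D.
  by split; [exists 2; exact: osc_le_ball|exists 0 => d /osc_le_ge0].
have gD : osc_le g (inf D).
  apply: osc_le_inf => e e0; have [d gd /ltW de] := inf_adherent e0 Dinf.
  exact: osc_leW de gd.
have Dmin h d : tail_convex h g -> osc_le h d -> inf D <= d.
  by move=> hg hd; apply: ge_inf; [exact: Dinf.2|exact: (gmin h d hg hd)].
have D0 : inf D <= 0.
  rewrite leNgt; apply/negP => D0; apply: nl1.
  (* Each node contains a whole sequence tail convex in [g], to which the minimality of the
     oscillation still applies. *)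
  pose good (I : finType) (K : I -> set (dual X)) := (0 < #|I|)%N /\
    exists2 z : I -> nat -> dual X, forall i, tail_convex (z i) g &
      forall i n, K i (z i n).
  apply: (@independent_contains_ell1 _ _ (inf D / 2) good).
  - by rewrite divr_gt0.
  - split; first by rewrite card_unit.
    by exists (fun=> g) => [_|_]; [exact: tail_convex_refl|exact: g1].
  - by move=> I K [_ [z _ zK]] i; exists (z i 0%N).
  - move=> I K [I0 [z zg zK]].
    have [x [hi [lo [x1 lohi xP]]]] := simultaneous_oscillation I0 D0 gD Dmin zg.
    have /choice[s sP] (Nb : nat * bool) : exists n, (Nb.1 <= n)%N /\
        forall i, if Nb.2 then hi <= z i n x else z i n x <= lo.
      by have [n Nn nP] := xP Nb.1 Nb.2; exists n.
    exists x, hi, lo; split=> //; split.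
      by rewrite card_prod card_bool muln_gt0 I0.
    (* Each half keeps terms of index at least [N] at place [N], which preserves tail convexity. *)
    exists (fun ib N => z ib.1 (s (N, ib.2))) => [ib N|[i b] N].
      exact: tail_hull_le (sP (N, ib.2)).1 _ (zg _ _).
    by split; [exact: zK|exact: (sP (N, b)).2].
have gcvg1 (x : X) : `|x| <= 1 -> cvg (g n x @[n --> \oo]).
  move=> x1; apply: R_complete; apply/cauchyP => e e0.
  have e20 : 0 < e / 2 by rewrite divr_gt0.
  have [N NP] := gD x x1 _ e20; exists (g N x); exists N => // n /= Nn.
  rewrite -ball_normE /=; have := NP N n (leqnn N) Nn; lra.
have gcvg (x : X) : cvg (g n x @[n --> \oo]).
  have [->|x0] := eqVneq x 0; first by apply: gcvg1; rewrite normr0.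
  have /cvg_ex[c gc] := gcvg1 (`|x|^-1 *: x) ltac:(by
    rewrite normrZ normfV normr_id mulVf ?normr_eq0).
  apply/cvg_ex; exists (`|x| *: (c : R^o)).
  have -> : (fun n => g n x : R^o) = (fun n => `|x| *: (g n (`|x|^-1 *: x) : R^o)).
    by apply/funext => n; rewrite -linearZ scalerA mulfV ?normr_eq0// scale1r.
  exact: cvgZl_tmp.
have gball : \forall n \near \oo, `|g n| <= 1 by exact: nearW.
have [l _ gl] := @dual_ptws_lim _ X (g @ \oo) 1 _ gball gcvg.
exists l; apply/weak_star_cvgP => x; exact: gl.
Qed.


End bourgain.

(** * Rosenthal's theorem *)

Definition unbounded (M : set nat) := forall N, exists2 n, (N <= n)%N & M n.

(** Successive thinning: [M j.+1] is chosen inside [M j] once [n j] is known, and [n j.+1] is then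
    taken in it beyond [n j]. The label [t j] records a choice made along the way. *)
Lemma diagonal_sets (T : Type) (Q : nat -> nat -> T -> set nat -> Prop) (M0 : set nat) :
  unbounded M0 ->
  (forall j n M, M `<=` M0 -> unbounded M ->
    exists t M', [/\ M' `<=` M, unbounded M' & Q j n t M']) ->
  exists (n : nat -> nat) (t : nat -> T) (M : nat -> set nat),
    [/\ {homo n : i j / (i < j)%N}, forall i j, (i <= j)%N -> M i (n j),
        M 0%N = M0 & forall j, Q j (n j) (t j) (M j.+1)].
Proof.
move=> uM0 Qex; have [t0 _] := Qex 0%N 0%N M0 (fun _ => id) uM0.
have /choice[F FP] (st : nat * nat * set nat) : exists r : T * set nat * nat,
    st.2 `<=` M0 -> unbounded st.2 -> [/\ r.1.2 `<=` st.2, unbounded r.1.2,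
      Q st.1.1 st.1.2 r.1.1 r.1.2, (st.1.2 < r.2)%N & r.1.2 r.2].
  case: st => -[j n] M /=.
  have [MM0|nMM0] := pselect (M `<=` M0); last by exists (t0, M, n) => /nMM0.
  have [uM|nuM] := pselect (unbounded M); last by exists (t0, M, n) => _ /nuM.
  have [t [M' [M'M uM' QtM']]] := Qex j n M MM0 uM.
  by have [m nm M'm] := uM' n.+1; exists (t, M', m).
have [n0 _ M0n0] := uM0 0%N.
pose st := fix st j := if j is j'.+1 then (j, (F (st j')).2, (F (st j')).1.2)
  else (0%N, n0, M0).
have stj j : (st j).1.1 = j by case: j.
have stM j : (st j).2 `<=` M0 /\ unbounded (st j).2.
  elim: j => [|j [IH1 IH2]]; first by split.
  have [FM uF _ _ _] := FP _ IH1 IH2.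
  by split=> //; apply: subset_trans IH1.
have stn j : (st j).2 (st j).1.2.
  by case: j => [//|j]; have [] := FP _ (stM j).1 (stM j).2.
exists (fun j => (st j).1.2), (fun j => (F (st j)).1.1), (fun j => (st j).2).
split=> [||//|j].
- by apply: homo_ltn; [exact: ltn_trans|move=> j; have [] := FP _ (stM j).1 (stM j).2].
- move=> i j /subnK <-; elim: (j - i)%N {-2}i => [|k IH] i'.
    by rewrite add0n; exact: stn.
  rewrite addSnnS; have [+ _ _ _ _] := FP _ (stM i').1 (stM i').2.
  by apply; exact: (IH i'.+1).
- by have [_ _ + _ _] := FP _ (stM j).1 (stM j).2; rewrite stj.
Qed.

Lemma pigeonhole_infinite (I : finType) (c : nat -> I) :
  exists i, unbounded [set j | c j = i].
Proof.
apply: contrapT => /forallNP nu.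
have /choice[N NP] i : exists N, forall j, (N <= j)%N -> c j <> i.
  have /existsNP[N nN] := nu i; exists N => j Nj cj; apply: nN.
  by exists j.
pose m := \max_i N i.
exact: (NP (c m) m (leq_bigmax (c m))).
Qed.

Section rosenthal_step.
Context {S : Type} (A : nat -> bool -> set S).

Definition oscillates (M : set nat) (s : S) :=
  forall b, unbounded [set n | M n /\ A n b s].

(** Quantifying over all unbounded [M'] makes the property hereditary, so [M] can be thinned
    freely. *)
Definition oscillating (I : finType) (K : I -> set S) :=
  exists2 M, unbounded M & forall i M', M' `<=` M -> unbounded M' ->
    exists2 s, K i s & oscillates M' s.

(* If no index were admissible, one could thin out successively so that the
   points of [K i `&` A n b] no longer oscillate; by the pigeonhole principle
   some pair [(i, b)] recurs, and an oscillating point of [K i] along the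
   corresponding indices meets some [A n b], a contradiction. *)
Lemma oscillating_refinement (I : finType) (K : I -> set S) :
  oscillating K -> exists n, oscillating (refinement A K n).
Proof.
move=> [M0 uM0 KM0]; apply: contrapT => nex.
pose Q (j n : nat) (ib : I * bool) (M : set nat) :=
  forall s, K ib.1 s -> A n ib.2 s -> ~ oscillates M s.
have [|n [c [M [n_incr nM M0E MQ]]]] := @diagonal_sets _ Q M0 uM0.
  move=> j n M MM0 uM; apply: contrapT => nt; apply: nex; exists n, M => //.
  move=> ib M' M'M uM'; apply: contrapT => ns; apply: nt; exists ib, M'.
  by split=> // s Ks As os; apply: ns; exists s.
have n_ge j : (j <= n j)%N.
  by elim: j => [//|j IH]; apply: leq_ltn_trans IH (n_incr _ _ (ltnSn j)).
have n_mono : {mono n : i j / (i < j)%N} by apply/leqW_mono/leq_mono.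
have [[i b] cib] := pigeonhole_infinite c.
have [||s Kis os] := KM0 i (n @` [set j | c j = (i, b)]).
- by move=> _ [j _ <-]; rewrite -M0E; exact: nM.
- move=> N; have [j Nj cj] := cib N.
  by exists (n j); [exact: leq_trans Nj (n_ge j)|exists j].
have [_ _ [[j0 /= cj0 <-] As]] := os b 0%N.
have Kcj : K (c j0).1 s by rewrite cj0.
apply: (MQ j0 s Kcj); first by rewrite cj0.
(* The indices [n j] beyond [n j0] belong to [M j0.+1], so [s] oscillates along that set too. *)
move=> b' N; have [m Nm [[j /= cj jm] As']] := os b' (maxn N (n j0).+1).
move: Nm As'; rewrite -jm geq_max n_mono => /andP[Nn j0j] As'.
by exists (n j) => //; split=> //; exact: nM.
Qed.

End rosenthal_step.

(** The supremum of [E] is the lower limit of [u]. If [u] crosses no rational gap infinitely often,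
    it is eventually below any rational above that limit. Rational levels leave countably many pairs
    to treat. *)
Lemma bounded_oscillation (R : realType) (u : nat -> R) (B : R) :
  (forall n, `|u n| <= B) -> ~ cvg (u @ \oo) ->
  exists p q : rat, [/\ p < q, unbounded [set n | u n <= ratr p] &
    unbounded [set n | ratr q <= u n]].
Proof.
move=> uB ncvg; apply: contrapT => npq; apply: ncvg.
pose E := [set t | exists N, forall n, (N <= n)%N -> t <= u n].
have Esup : has_sup E.
  split; first by exists (- B), 0%N => n _; have := uB n; rewrite ler_norml => /andP[].
  exists B => t [N NP]; apply: le_trans (NP N (leqnn _)) _.
  by have := uB N; rewrite ler_norml => /andP[].
apply/cvg_ex; exists (sup E); apply/cvgrPdist_lt => e e0.
have [t [N1 N1P] te] := sup_adherent e0 Esup.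
have [q] := rat_in_itvoo (ltac:(by rewrite ltrDl) : sup E < sup E + e).
rewrite in_itv /= => /andP[q1 q2]; have [p] := rat_in_itvoo q1.
rewrite in_itv /= => /andP[p1 p2].
have [N2 N2P] : exists N, forall n, (N <= n)%N -> u n < ratr q.
  apply: contrapT => nN; apply: npq; exists p, q; split.
  - by rewrite -(ltr_rat R).
  - move=> N; apply: contrapT => nn.
    suff : E (ratr p) by move=> /(ub_le_sup Esup.2); rewrite leNgt p1.
    exists N => n Nn; rewrite leNgt; apply/negP => /ltW un; apply: nn.
    by exists n.
  - move=> N; apply: contrapT => nn; apply: nN; exists N => n Nn.
    by rewrite ltNge; apply/negP => un; apply: nn; exists n.
exists (maxn N1 N2) => // n /=; rewrite geq_max => /andP[/N1P n1 /N2P n2].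
by rewrite ltr_norml; apply/andP; split; lra.
Qed.

(** For each rational pair the indices are thinned until no functional in the unit ball oscillates
    across it; a diagonal over all pairs leaves only convergent scalar sequences. *)
Theorem rosenthal (R : realType) (X : completeNormedModType R) (x : nat -> X) :
  ~ contains_isomorphic_subspace X (ell1 R) -> (forall n, `|x n| <= 1) ->
  exists2 sigma : nat -> nat, {homo sigma : i j / (i < j)%N} &
    forall f : dual X, cvg (f (x (sigma n)) @[n --> \oo]).
Proof.
move=> nl1 x1.
pose A (p q : rat) (n : nat) (b : bool) : set (dual X) :=
  [set f | if b then ratr q <= f (x n) else f (x n) <= ratr p].
have thin p q M : p < q -> unbounded M -> exists2 M', M' `<=` M &
    unbounded M' /\ forall f : dual X, `|f| <= 1 -> ~ oscillates (A p q) M' f.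
  (* If every unbounded subset of [M] had an oscillating functional in the unit ball, that ball
     would be the root of a tree giving l1. *)
  move=> pq uM; apply: contrapT => nM'; apply: nl1.
  apply: (@independent_contains_ell1 _ _ (ratr q - ratr p) (@oscillating _ (A p q))).
  - by rewrite subr_gt0 ltr_rat.
  - exists M => // _ M' M'M uM'; apply: contrapT => nf; apply: nM'.
    by exists M' => //; split=> // f f1 of_; apply: nf; exists f.
  - by move=> I K [M1 uM1 KM1] i; have [s Ks _] := KM1 i M1 (fun _ => id) uM1; exists s.
  - move=> I K /oscillating_refinement[n Kn].
    exists (x n), (ratr q), (ratr p); split=> //; lra.
(* An enumeration of rational pairs; the default [(0, 0)] imposes no condition since [Q] assumes a
   strict inequality. *)
pose pq (k : nat) : rat * rat := odflt (0, 0) (choice.unpickle k).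
pose Q (k n : nat) (t : unit) (M : set nat) := (pq k).1 < (pq k).2 ->
  forall f : dual X, `|f| <= 1 -> ~ oscillates (A (pq k).1 (pq k).2) M f.
have [||sigma [t [M [s_incr sM _ MQ]]]] := @diagonal_sets unit Q setT.
- by move=> N; exists N.
- move=> k n M _ uM; exists tt.
  have [lt_pq|npq] := pselect ((pq k).1 < (pq k).2); last by exists M; split=> // /npq.
  by have [M' M'M [uM' M'P]] := thin _ _ _ lt_pq uM; exists M'; split=> // _ f; exact: M'P.
exists sigma => //.
have s_ge j : (j <= sigma j)%N.
  by elim: j => [//|j IH]; apply: leq_ltn_trans IH (s_incr _ _ (ltnSn j)).
have cvg1 (f : dual X) : `|f| <= 1 -> cvg (f (x (sigma n)) @[n --> \oo]).
  move=> f1; apply: contrapT => /(@bounded_oscillation R (fun n => f (x (sigma n))) 1).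
  case=> [n|p [q [lt_pq up uq]]]; first exact: dual_le_ball.
  pose k := choice.pickle (p, q); have pqk : pq k = (p, q) by rewrite /pq choice.pickleK.
  apply: (MQ k _ f f1); rewrite pqk// => b N.
  have u_b : unbounded [set n | A p q (sigma n) b f] by case: b; [exact: uq|exact: up].
  have [j kj Aj] := u_b (maxn N k.+1); move: kj; rewrite geq_max => /andP[Nj kj].
  by exists (sigma j); [exact: leq_trans (s_ge j)|split=> //; exact: sM].
move=> f; have f0 : 0 < `|f| + 1 by rewrite ltr_wpDl.
have /cvg_ex[c fc] := cvg1 ((`|f| + 1)^-1 *: f) ltac:(by
  rewrite normrZ normfV (gtr0_norm f0) mulrC ler_pdivrMr// mul1r lerDl).
apply/cvg_ex; exists ((`|f| + 1) *: (c : R^o)).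
have -> : (fun n => f (x (sigma n)) : R^o) =
    (fun n => (`|f| + 1) *: (((`|f| + 1)^-1 *: f) (x (sigma n)) : R^o)).
  apply/funext => n; have -> : ((`|f| + 1)^-1 *: f) (x (sigma n)) =
    (`|f| + 1)^-1 * f (x (sigma n)) by [].
  by rewrite /GRing.scale/= mulrA mulfV ?gt_eqF// mul1r.
exact: cvgZl_tmp.
Qed.

(** * Spaces with property (K) *)

(** Choice depending on the list of all earlier terms, for the array below. *)
Lemma history_choice (T : Type) (Q : seq T -> T -> Prop) :
  (forall s, exists t, Q s t) -> exists u : nat -> T, forall n, Q (mkseq u n) (u n).
Proof.
move=> /choice[F FP].
pose s n := iter n (fun s => rcons s (F s)) [::].
exists (fun n => F (s n)) => n; suff -> : mkseq (fun n => F (s n)) n = s n by exact: FP.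
by elim: n => [//|n IH]; rewrite mkseqS IH.
Qed.

Section nonreflexive.
Context {R : realType} {X : completeNormedModType R}.

(** The isometric image of a complete space is closed: without such an [r], the points mapped near
    [phi] would generate a Cauchy filter whose limit is mapped to [phi]. *)
Lemma bidual_eval_dist (phi : dual (dual X)) : ~ range (@bidual_eval R X) phi ->
  exists2 r, 0 < r & forall x, r <= `|bidual_eval x - phi|.
Proof.
move=> nphi; apply: contrapT => nr; apply: nphi.
have ex e : 0 < e -> exists x : X, `|bidual_eval x - phi| < e.
  move=> e0; apply: contrapT => nx; apply: nr; exists e => // x.
  by rewrite leNgt; apply/negP => xe; apply: nx; exists x.
have JB x y : bidual_eval (x - y) = bidual_eval x - bidual_eval y.
  by apply: dualP => f; rewrite /= linearB.
pose F := filter_from [set e : R | 0 < e]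
  (fun e => [set x : X | `|bidual_eval x - phi| < e]).
have FF : ProperFilter F.
  apply: filter_from_proper; last by move=> e /ex[x xe]; exists x.
  apply: filter_from_filter; first by exists 1 => /=.
  move=> e e' /= e0 e'0; exists (Num.min e e'); first by rewrite /= lt_min e0.
  by move=> x /=; rewrite lt_min => /andP[].
have Fc : cauchy F.
  apply/cauchyP => e e0; have e20 : 0 < e / 2 by rewrite divr_gt0.
  have [x xe] := ex _ e20; exists x; exists (e / 2) => // y ye.
  rewrite -ball_normE /= -bidual_eval_norm JB.
  have -> : bidual_eval x - bidual_eval y =
    (bidual_eval x - phi) - (bidual_eval y - phi) by rewrite opprB addrA subrK.
  rewrite [ltRHS]splitr.
  apply: le_lt_trans (ler_normB _ _) _.
  apply: ltrD.
    exact: xe.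
  exact: ye.
have /cvg_ex[x Fx] : cvg F by exact: cauchy_cvg.
exists x => //; apply/eqP; rewrite -subr_eq0 -normr_le0.
apply/ler_addgt0Pr => e e0; rewrite add0r.
have e20 : 0 < e / 2 by rewrite divr_gt0.
have Fphi : F [set y | `|bidual_eval y - phi| < e / 2] by exists (e / 2).
have Fxe : F (ball x (e / 2)) by apply: Fx; exact: nbhsx_ballx.
have /filter_ex[y [/= y1 y2]] : F ([set y | `|bidual_eval y - phi| < e / 2] `&`
  ball x (e / 2)) by exact: filterI.
move: y2; rewrite -ball_normE /= -bidual_eval_norm JB => y2.
have -> : bidual_eval x - phi =
  (bidual_eval x - bidual_eval y) + (bidual_eval y - phi) by rewrite addrA subrK.
by rewrite (le_trans (ler_normD _ _))// [leRHS]splitr lerD// ltW.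
Qed.

(* James' triangular array. *)
Lemma nonreflexive_array : ~ reflexive_space X ->
  exists (theta : R) (f : nat -> dual X) (x : nat -> X), [/\ 0 < theta,
    forall n, `|f n| <= 1, forall n, `|x n| <= 1,
    forall k n, (k < n)%N -> `|f n (x k)| <= theta / 10 &
    forall n k, (n <= k)%N -> theta * (4 / 5) <= f n (x k)].
Proof.
move=> nrefl.
have [phi0 nphi0] : exists phi, ~ range (@bidual_eval R X) phi.
  apply: contrapT => /forallNP nphi; apply: nrefl; apply/seteqP; split=> // phi _.
  exact: contrapT (nphi phi).
have c0 : 0 < `|phi0| + 1 by rewrite ltr_wpDl.
pose phi := (`|phi0| + 1)^-1 *: phi0.
have phi1 : `|phi| <= 1.
  by rewrite normrZ normfV (gtr0_norm c0) mulrC ler_pdivrMr// mul1r lerDl.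
have [|r r0 rP] := @bidual_eval_dist phi.
  move=> [x _ xphi]; apply: nphi0; exists ((`|phi0| + 1) *: x) => //.
  apply: dualP => f /=; rewrite linearZ /=.
  have -> : f x = phi f by rewrite -xphi.
  have -> : phi f = (`|phi0| + 1)^-1 * phi0 f by [].
  by rewrite /GRing.scale/= mulrA mulfV ?gt_eqF// mul1r.
have [|||Psi Psi1 PsiP] := @separation _ _ (range (@bidual_eval R X)) phi r.
- move=> a b _ _ _ _ _ [x _ <-] [y _ <-]; exists (a *: x + b *: y) => //.
  by apply: dualP => f; rewrite /= linearD !linearZ.
- by exists (bidual_eval 0), 0.
- by move=> _ [x _ <-]; exact: rP.
(* A functional bounded below on a subspace vanishes there; [t] is the multiple whose value falls 1
   short of the bound [Psi phi + r]. *)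
have Psi0 x : Psi (bidual_eval x) = 0.
  apply/eqP/negP => /negP Psix.
  pose t := (Psi phi + r - 1) / Psi (bidual_eval x).
  have := PsiP (bidual_eval (t *: x)) (ex_intro2 _ _ _ I erefl).
  have -> : bidual_eval (t *: x) = t *: bidual_eval x.
    by apply: dualP => f; rewrite /= linearZ.
  have -> : Psi (t *: bidual_eval x) = Psi phi + r - 1.
    by rewrite linearZ; exact: divfK.
  lra.
have Psiphi : Psi phi <= - r.
  by have := PsiP (bidual_eval 0) (ex_intro2 _ _ _ I erefl); rewrite Psi0; lra.
have e0 : 0 < r / 10 by rewrite divr_gt0.
(* Goldstine's theorem for [- Psi] gives the functional, large under [phi] and small at earlier
   vectors; for [phi] it gives the vector, against the new functional and the earlier ones. Two
   losses of [r / 10] leave [4 / 5] of [r]. *)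
pose Q (s : seq (dual X * X)) (t : dual X * X) := [/\ `|t.1| <= 1, `|t.2| <= 1,
  r - r / 10 <= phi t.1, (forall p, p \in s -> `|t.1 p.2| <= r / 10) &
  (forall p, p \in t :: s -> `|p.1 t.2 - phi p.1| <= r / 10) ].
have [s|u uQ] := @history_choice _ Q.
  have NPsi1 : `|- Psi| <= 1 by rewrite normrN.
  have [f f1 fP] := goldstine (phi :: [seq bidual_eval p.2 | p <- s]) NPsi1 e0.
  have [x x1 xP] := goldstine (f :: [seq p.1 | p <- s]) phi1 e0.
  exists (f, x); split=> //=.
  - have := fP phi (mem_head _ _).
    have -> : (- Psi) phi = - Psi phi by [].
    by rewrite ler_norml => /andP[]; lra.
  - move=> p ps; have := fP (bidual_eval p.2).
    have -> : (- Psi) (bidual_eval p.2) = 0.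
      by have -> : (- Psi) (bidual_eval p.2) = - Psi (bidual_eval p.2) by []; rewrite Psi0 oppr0.
    rewrite subr0; apply; rewrite in_cons; apply/orP; right.
    exact: (map_f (fun p => bidual_eval p.2) ps).
  - move=> p; rewrite in_cons => /predU1P[->/=|ps]; first exact/xP/mem_head.
    by apply: xP; rewrite in_cons; apply/orP; right; exact: map_f.
have mem_u k n : (k < n)%N -> u k \in mkseq u n.
  by move=> kn; apply: map_f; rewrite mem_iota.
exists r, (fun n => (u n).1), (fun n => (u n).2); split=> //.
- by move=> n; case: (uQ n).
- by move=> n; case: (uQ n).
- by move=> k n kn; have [_ _ _ + _] := uQ n; apply; exact: mem_u.
- move=> n k nk; have [_ _ phin _ _] := uQ n; have [_ _ _ _ +] := uQ k.
  move=> /(_ (u n)); rewrite in_cons.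
  have -> : (u n == u k) || (u n \in mkseq u k).
    by move: nk; rewrite leq_eqVlt => /predU1P[->|/mem_u ->]; rewrite ?eqxx ?orbT.
  by move=> /(_ isT); rewrite ler_norml => /andP[]; lra.
Qed.

Lemma property_K_reflexive : ~ contains_isomorphic_subspace X (ell1 R) ->
  property_K X -> reflexive_space X.
Proof.
move=> nl1 KX; apply: contrapT => /nonreflexive_array.
move=> [theta [f [x [theta0 f1 x1 fx0 fx1]]]].
have [h hf hcvg] := bourgain nl1 f1.
have [g /block_tail_convex gh [l /mackey_cvgP gl]] := KX h hcvg.
have gf := tail_convex_trans gh hf.
have gx0 k n : (k < n)%N -> `|g n (x k)| <= theta / 10.
  move=> kn; apply: (gf n [set u : dual X | `|u (x k)| <= theta / 10]).
    move=> a b u v a0 b0 ab /= ux vx.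
    change (`|a * u (x k) + b * v (x k)| <= theta / 10).
    rewrite (le_trans (ler_normD _ _))// !normrM (ger0_norm a0) (ger0_norm b0).
    by have := ler_wpM2l a0 ux; have := ler_wpM2l b0 vx; nra.
  by move=> m nm /=; exact/fx0/(leq_trans kn).
(* The threshold [m] varies with the functional, yet the condition is convex: the larger of two
   thresholds serves a combination. *)
have gx1 n : exists m, forall k, (m <= k)%N -> theta * (4 / 5) <= g n (x k).
  apply: (gf n [set u : dual X | exists m, forall k, (m <= k)%N ->
    theta * (4 / 5) <= u (x k)]).
    move=> a b u v a0 b0 ab /= [m ux] [m' vx]; exists (maxn m m') => k.
    rewrite geq_max => /andP[/ux uk /vx vk].
    change (theta * (4 / 5) <= a * u (x k) + b * v (x k)).
    by have := ler_wpM2l a0 uk; have := ler_wpM2l b0 vk; nra.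
  by move=> m _; exists m => k; exact: fx1.
have [sigma s_incr scvg] := rosenthal nl1 x1.
have s_ge j : (j <= sigma j)%N.
  by elim: j => [//|j IH]; apply: leq_ltn_trans IH (s_incr _ _ (ltnSn j)).
(* The functional of index [(sigma i).+1] is small at [x (sigma i)] and large at [x (sigma (b i))],
   hence large at the difference [y i]. *)
have /choice[b bP] i : exists b, (i <= b)%N /\
    theta * (4 / 5) <= g (sigma i).+1 (x (sigma b)).
  have [m mP] := gx1 (sigma i).+1; exists (maxn i m); rewrite leq_maxl; split=> //.
  by apply: mP; apply: leq_trans (s_ge _); exact: leq_maxr.
pose y i := x (sigma (b i)) - x (sigma i).
have wK : weakly_compact ([set 0] `|` range y).
  apply: weakly_compact_cvg0 => phi.
  have /cvg_ex[c pc] := scvg phi.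
  have b_oo : b @ \oo --> \oo.
    by move=> A [N _ NA]; exists N => // i /= Ni; apply: NA; exact: leq_trans Ni (bP i).1.
  have pbc : phi (x (sigma (b n))) @[n --> \oo] --> c by exact: (cvg_comp _ _ b_oo pc).
  have -> : (fun n => phi (y n) : R^o) =
      (fun n => phi (x (sigma (b n))) - phi (x (sigma n)) : R^o).
    by apply/funext => n; rewrite linearB.
  by rewrite -(subrr (c : R^o)); exact: cvgB.
have [N _ NP] := gl _ wK (theta / 10) ltac:(by rewrite divr_gt0).
pose n := (sigma N).+1.
have Nn : (N <= n)%N by exact: leqW (s_ge N).
(* Beyond both indices occurring in [y N], so [g m] is small at both vectors. *)
pose m := maxn N (maxn (sigma N) (sigma (b N))).+1.
have yK : ([set 0] `|` range y) (y N) by right; exists N.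
have gn := NP n Nn _ yK.
have gm := NP m (leq_maxl _ _) _ yK.
have gnN : theta * (7 / 10) <= g n (y N).
  rewrite linearB; have := (bP N).2; have := gx0 _ _ (ltnSn (sigma N)).
  by rewrite ler_norml -/n => /andP[]; lra.
have gmN : g m (y N) <= theta / 5.
  have sm : (sigma N < m)%N by rewrite /m; lia.
  have sbm : (sigma (b N) < m)%N by rewrite /m; lia.
  rewrite linearB; have := gx0 _ _ sm; have := gx0 _ _ sbm.
  by rewrite !ler_norml => /andP[_ ?] /andP[? _]; lra.
(* The values of [g n] and [g m] at [y N] differ by at least [theta / 2], yet both are within
   [theta / 10] of that of [l]. *)
move: gn gm; rewrite !ltr_norml => /andP[_ ?] /andP[? _]; lra.
Qed.

End nonreflexive.

Theorem theorem2p1 (R : realType) (X : completeNormedModType R)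
    (hX : ~ contains_isomorphic_subspace X (ell1 R)) :
  reflexive_space X <-> property_K X.
Proof.
by split; [exact: reflexive_property_K|exact: property_K_reflexive].
Qed.
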